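(* There is a polynomial-time algorithm which, given a tournament $T=(V,A)$ with non-negative (rational) vertex weights $w:V\to\mathbb{Q}_{\ge 0}$, outputs a feedback vertex set of $T$ whose weight is at most $\frac{7}{3}$ times the minimum weight of a feedback vertex set of $T$.
   Context: A tournament is an orientation of a complete graph. A feedback vertex set (FVS) of a tournament $T=(V,A)$ is a set $S\subseteq V$ such that $T[V\setminus S]$ contains no directed cycle. The weight of a set $S$ is $w(S)=\sum_{v\in S}w(v)$. *)

(* Defs.v *)
From HB Require Import structures.
From mathcomp Require Import all_boot all_order all_algebra.

Set Implicit Arguments.
Unset Strict Implicit.
Unset Printing Implicit Defensive.

Import Order.TTheory GRing.Theory Num.Theory.

(** The machine model is the WHILE language over binary trees with its
    unit-cost time measure (N. D. Jones, Computability and Complexity: From a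
    Programming Perspective, MIT Press, 1997). Trees are shared on assignment,
    so each elementary operation is a constant number of pointer operations,
    and WHILE programs and Turing machines simulate each other with polynomial
    overhead. *)

Inductive tree : Type :=
| Nil
| Cons of tree & tree.

Definition hd (d : tree) : tree := if d is Cons a _ then a else Nil.
Definition tl (d : tree) : tree := if d is Cons _ b then b else Nil.

Fixpoint tree_size (d : tree) : nat :=
  if d is Cons a b then (tree_size a + tree_size b).+1 else 1.

Definition store : Type := nat -> tree.

Definition upd (s : store) (x : nat) (d : tree) : store :=
  fun y => if y == x then d else s y.

Inductive expr : Type :=
| EVar of nat
| EConst of tree
| ECons of expr & expr
| EHd of expr
| ETl of expr.

Fixpoint eval (s : store) (e : expr) : tree :=
  match e with
  | EVar x => s x
  | EConst d => d
  | ECons e1 e2 => Cons (eval s e1) (eval s e2)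
  | EHd e1 => hd (eval s e1)
  | ETl e1 => tl (eval s e1)
  end.

Fixpoint etime (e : expr) : nat :=
  match e with
  | EVar _ | EConst _ => 1
  | ECons e1 e2 => (etime e1 + etime e2).+1
  | EHd e1 | ETl e1 => (etime e1).+1
  end.

Inductive cmd : Type :=
| CAssign of nat & expr
| CSeq of cmd & cmd
| CIf of expr & cmd & cmd
| CWhile of expr & cmd.

(** [exec c s t s']: started in store [s], the command [c] halts after exactly
    [t] time units in store [s']. [Nil] plays the role of false in tests. *)
Inductive exec : cmd -> store -> nat -> store -> Prop :=
| ExecAssign s x e :
    exec (CAssign x e) s (etime e).+1 (upd s x (eval s e))
| ExecSeq c1 c2 s s1 s2 t1 t2 :
    exec c1 s t1 s1 -> exec c2 s1 t2 s2 ->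
    exec (CSeq c1 c2) s (t1 + t2) s2
| ExecIfTrue e c1 c2 s s' t :
    eval s e <> Nil -> exec c1 s t s' ->
    exec (CIf e c1 c2) s (etime e + t).+1 s'
| ExecIfFalse e c1 c2 s s' t :
    eval s e = Nil -> exec c2 s t s' ->
    exec (CIf e c1 c2) s (etime e + t).+1 s'
| ExecWhileTrue e c s s1 s2 t1 t2 :
    eval s e <> Nil -> exec c s t1 s1 -> exec (CWhile e c) s1 t2 s2 ->
    exec (CWhile e c) s (etime e + t1 + t2).+1 s2
| ExecWhileFalse e c s :
    eval s e = Nil ->
    exec (CWhile e c) s (etime e).+1 s.

Lemma exec_deterministic c s t1 s1 t2 s2 :
  exec c s t1 s1 -> exec c s t2 s2 -> t1 = t2 /\ s1 = s2.
Proof.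
move=> H; elim: H t2 s2 => {c s t1 s1}.
- by move=> s x e t2 s2 H; inversion H.
- move=> c1 c2 s s1 s2 t1 t2 _ IH1 _ IH2 t' s' H.
  inversion H as [|? ? ? ? ? ? ? H1 H2| | | |]; subst.
  by have [? ?] := IH1 _ _ H1; subst; have [-> ->] := IH2 _ _ H2.
- move=> e c1 c2 s s1 t ne _ IH t' s' H; inversion H; subst => //.
  by match goal with h : exec c1 _ _ _ |- _ => have [-> ->] := IH _ _ h end.
- move=> e c1 c2 s s1 t eq _ IH t' s' H; inversion H; subst => //.
  by match goal with h : exec c2 _ _ _ |- _ => have [-> ->] := IH _ _ h end.
- move=> e c s s1 s2 t1 t2 ne _ IH1 _ IH2 t' s' H.
  inversion H as [| | | |? ? ? ? ? ? ? _ H1 H2|]; subst => //.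
  by have [? ?] := IH1 _ _ H1; subst; have [-> ->] := IH2 _ _ H2.
- by move=> e c s eq t' s' H; inversion H; subst.
Qed.

(** Variable 0 holds the input at the start and the output at the end; all
    other variables start as [Nil]. *)
Definition runs (c : cmd) (input : tree) (t : nat) (output : tree) : Prop :=
  exists s : store, exec c (upd (fun=> Nil) 0 input) t s /\ s 0 = output.

Definition enc_bool (b : bool) : tree := if b then Cons Nil Nil else Nil.

Definition enc_seq (X : Type) (f : X -> tree) (s : seq X) : tree :=
  foldr (fun x d => Cons (f x) d) Nil s.

(** Binary digits, least significant first, without leading zeros;
    [up_log 2 n.+1] is the number of binary digits of [n]. *)
Definition nat_bits (n : nat) : seq bool :=
  [seq odd (n %/ 2 ^ i) | i <- iota 0 (up_log 2 n.+1)].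

Definition enc_nat (n : nat) : tree := enc_seq enc_bool (nat_bits n).

(** Injective on non-negative rationals only: the sign is not recorded. *)
Definition enc_rat (q : rat) : tree :=
  Cons (enc_nat `|numq q|%N) (enc_nat `|denq q|%N).

(** Adjacency matrix (row by row) together with the list of weights, both in
    the order [enum V]. *)
Definition enc_instance (V : finType) (A : rel V) (w : V -> rat) : tree :=
  Cons (enc_seq (fun x => enc_seq (fun y => enc_bool (A x y)) (enum V)) (enum V))
       (enc_seq (fun x => enc_rat (w x)) (enum V)).

(** Characteristic vector in the order [enum V]. *)
Definition enc_set (V : finType) (S : {set V}) : tree :=
  enc_seq (fun x => enc_bool (x \in S)) (enum V).

Definition tournament (V : finType) (A : rel V) : Prop :=
  irreflexive A /\ forall x y : V, x != y -> A x y (+) A y x.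

Definition directed_cycle (V : finType) (A : rel V) (c : seq V) : Prop :=
  c != [::] /\ ucycle A c.

Definition feedback_vertex_set (V : finType) (A : rel V) (S : {set V}) : Prop :=
  forall c : seq V, {subset c <= ~: S} -> ~ directed_cycle A c.

Definition weight (V : finType) (w : V -> rat) (S : {set V}) : rat :=
  (\sum_(v in S) w v)%R.

Definition min_fvs_weight (V : finType) (A : rel V) (w : V -> rat) (m : rat)
  : Prop :=
  (exists2 S : {set V}, feedback_vertex_set A S & weight w S = m) /\
  (forall S : {set V}, feedback_vertex_set A S -> (m <= weight w S)%R).

(* Main.v *)
(** For a vertex [v], let [B v] be the bipartite graph between the in- and the
    out-neighbours of [v] whose edges are the triangles through [v]. Seven
    vertices consisting of [v] and an induced matching of size three in [B v]
    cannot be hit by fewer than three vertices, so that a local ratio step on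
    them (subtract their minimum weight) costs a factor 7/3. One pass over all
    7-tuples leaves a set [U] of vertices of positive weight without such a
    pattern.

    On [U] the problem is solved exactly. Let [p 1 -> ... -> p m] be a maximum
    transitive subset of [U], let [L i] be the in-neighbours of [p i] dominating
    all later [p j], and [R i] the set of vertices of [U] dominated by [p i] and
    [L i]. The sets [R i] decrease with [i]; the absence of patterns makes [R i]
    the common out-neighbourhood of [p i] and at most two vertices of [L i].
    Hence a maximum transitive subset is found by dynamic programming over
    triples of vertices.

    Polynomial running time is obtained from closure properties of the class of
    tree functions computable by WHILE programs in polynomial time with outputs
    of polynomial size; weights are first brought to a common denominator. *)

Require Import Defs.
From HB Require Import structures.
From mathcomp Require Import all_boot all_order all_algebra.
From mathcomp Require Import zify.

(* [Cons] must denote the tree constructor, not the one of [seq]. *)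
Import Defs.

Set Implicit Arguments.
Unset Strict Implicit.
Unset Printing Implicit Defensive.

(** * Polynomial-time functions on trees *)

Definition poly (p : nat -> nat) : Prop :=
  exists a k, forall n, p n <= a * n.+1 ^ k.

(** A closed form for polynomial bounds: unlike an arbitrary function satisfying [poly], it is
    monotone in [n], so one bound can be substituted into another. *)
Definition pb (a k n : nat) : nat := a * n.+1 ^ k.

Lemma poly_le p q : (forall n, p n <= q n) -> poly q -> poly p.
Proof. by move=> pq [a [k qk]]; exists a, k => n; apply: leq_trans (pq n) (qk n). Qed.

Lemma poly_const c : poly (fun=> c).
Proof. by exists c, 0 => n; rewrite expn0 muln1. Qed.

Lemma poly_id : poly id.
Proof. by exists 1, 1 => n; rewrite expn1 mul1n. Qed.

Lemma poly_add p q : poly p -> poly q -> poly (fun n => p n + q n).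
Proof.
move=> [a [k pk]] [b [l ql]]; exists (a + b), (k + l) => n.
have hk : n.+1 ^ k <= n.+1 ^ (k + l) by apply: leq_pexp2l => //; rewrite leq_addr.
have hl : n.+1 ^ l <= n.+1 ^ (k + l) by apply: leq_pexp2l => //; rewrite leq_addl.
rewrite mulnDl; apply: leq_add.
- by apply: leq_trans (pk n) _; rewrite leq_mul2l hk orbT.
- by apply: leq_trans (ql n) _; rewrite leq_mul2l hl orbT.
Qed.

Lemma poly_mul p q : poly p -> poly q -> poly (fun n => p n * q n).
Proof.
move=> [a [k pk]] [b [l ql]]; exists (a * b), (k + l) => n.
by rewrite expnD mulnACA; apply: leq_mul.
Qed.

Lemma poly_pb a k p : poly p -> poly (fun n => pb a k (p n)).
Proof.
move=> hp; rewrite /pb; apply: poly_mul (poly_const a) _.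
elim: k => [|k IH]; first exact: poly_le (poly_const 1).
apply: (@poly_le _ (fun n => (1 + p n) * (p n).+1 ^ k)) => [n|].
  by rewrite expnS.
exact: poly_mul (poly_add (poly_const 1) hp) IH.
Qed.

Ltac poly_tac := repeat first [ exact: poly_id | exact: poly_const | assumption
  | apply: poly_pb | apply: poly_add | apply: poly_mul ].

Lemma leq_pb a k m n : m <= n -> pb a k m <= pb a k n.
Proof. by move=> mn; rewrite leq_mul2l; apply/orP; right; case: k => // k; rewrite leq_exp2r. Qed.

Lemma tree_size_gt0 d : 0 < tree_size d.
Proof. by case: d. Qed.

(** [c] may leave arbitrary values in the variables below [N], and is robust
    against arbitrary initial values there; this makes programs composable
    without renaming. *)
Definition computes (c : cmd) (N : nat) (f : tree -> tree) (T : tree -> nat) :=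
  forall s, exists t s', [/\ exec c s t s', s' 0 = f (s 0), t <= T (s 0) &
    forall y, N <= y -> s' y = s y].

(** The bound on the output size belongs to the class because a composition runs the second program
    on that output. *)
Definition FP (f : tree -> tree) : Prop :=
  exists c N a k, [/\ 0 < N,
    forall x, tree_size (f x) <= pb a k (tree_size x) &
    computes c N f (fun x => pb a k (tree_size x))].

Definition FP2 (f : tree -> tree -> tree) : Prop :=
  FP (fun e => f (hd e) (tl e)).

Definition FP3 (f : tree -> tree -> tree -> tree) : Prop :=
  FP (fun e => f (hd e) (hd (tl e)) (tl (tl e))).

Lemma FP_intro f c N p q : 0 < N -> poly p -> poly q ->
  (forall x, tree_size (f x) <= p (tree_size x)) ->
  computes c N f (fun x => q (tree_size x)) -> FP f.
Proof.
move=> N0 hp hq sz cf; have [a [k pq]] := poly_add hp hq.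
exists c, N, a, k; split=> // [x|s].
  by apply: leq_trans (pq _); apply: leq_trans (sz x) _; rewrite leq_addr.
have [t [s' [h1 h2 h3 h4]]] := cf s; exists t, s'; split=> //.
by apply: leq_trans (pq _); apply: leq_trans h3 _; rewrite leq_addl.
Qed.

Lemma FP_size f : FP f -> exists a k, forall x, tree_size (f x) <= pb a k (tree_size x).
Proof. by move=> [_ [_ [a [k [_ h _]]]]]; exists a, k. Qed.

Lemma FP_expr f e p : poly p -> (forall s, eval s e = f (s 0)) ->
  (forall x, tree_size (f x) <= p (tree_size x)) -> FP f.
Proof.
move=> hp ef sz; apply: (@FP_intro _ (CAssign 0 e) 1 p (fun=> (etime e).+1)) => //.
  exact: poly_const.
move=> s; exists (etime e).+1, (upd s 0 (eval s e)); split=> //.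
- exact: ExecAssign.
- by rewrite /upd eqxx.
- by case.
Qed.

Lemma FP_id : FP (fun x => x).
Proof. exact: (@FP_expr _ (EVar 0) _ poly_id). Qed.

Lemma FP_const d : FP (fun=> d).
Proof. exact: (@FP_expr _ (EConst d) _ (poly_const (tree_size d))). Qed.

Lemma FP_comp f g : FP f -> FP g -> FP (fun x => g (f x)).
Proof.
move=> [c [N [a [k [N0 sf cf]]]]] [d [M [b [l [M0 sg cg]]]]].
apply: (@FP_intro _ (CSeq c d) (maxn N M) (fun n => pb b l (pb a k n))
   (fun n => pb a k n + pb b l (pb a k n))); first by rewrite leq_max N0.
- exact/poly_pb/poly_pb/poly_id.
- by apply: poly_add; do ![apply: poly_pb]; apply: poly_id.
- by move=> x; apply: leq_trans (sg _) _; apply: leq_pb.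
move=> s; have [t [s' [h1 h2 h3 h4]]] := cf s.
have [t' [s'' [k1 k2 k3 k4]]] := cg s'; exists (t + t'), s''; split.
- exact: ExecSeq h1 k1.
- by rewrite k2 h2.
- by apply: leq_add => //; apply: leq_trans k3 _; rewrite h2 leq_pb.
- by move=> y; rewrite geq_max => /andP[hN hM]; rewrite k4 // h4.
Qed.

Lemma size_hd d : tree_size (hd d) <= tree_size d.
Proof. by case: d => //= a b; lia. Qed.

Lemma size_tl d : tree_size (tl d) <= tree_size d.
Proof. by case: d => //= a b; lia. Qed.

Lemma FP_hd f : FP f -> FP (fun x => hd (f x)).
Proof.
move=> hf; apply: (FP_comp hf).
by apply: (@FP_expr _ (EHd (EVar 0)) _ poly_id) => //; apply: size_hd.
Qed.

Lemma FP_tl f : FP f -> FP (fun x => tl (f x)).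
Proof.
move=> hf; apply: (FP_comp hf).
by apply: (@FP_expr _ (ETl (EVar 0)) _ poly_id) => //; apply: size_tl.
Qed.

(** The input is saved in variable [K] and the first result in [K.+1], both beyond the reach of the
    two programs. *)
Lemma FP_Cons f g : FP f -> FP g -> FP (fun x => Cons (f x) (g x)).
Proof.
move=> [c [N [a [k [N0 sf cf]]]]] [d [M [b [l [M0 sg cg]]]]].
pose K := maxn N M; have NK : N <= K by rewrite leq_maxl.
have MK : M <= K by rewrite leq_maxr.
pose prog := CSeq (CAssign K (EVar 0)) (CSeq c (CSeq (CAssign K.+1 (EVar 0))
  (CSeq (CAssign 0 (EVar K)) (CSeq d (CAssign 0 (ECons (EVar K.+1) (EVar 0))))))).
apply: (@FP_intro _ prog K.+2 (fun n => pb a k n + pb b l n + 1)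
   (fun n => pb a k n + pb b l n + 10)) => //.
- by poly_tac.
- by poly_tac.
- by move=> x /=; rewrite addn1 ltnS leq_add.
move=> s.
pose s1 := upd s K (s 0).
have K0 : (0 == K) = false by apply/negP => /eqP; lia.
have [t1 [s2 [h1 h2 h3 h4]]] := cf s1.
have e1 : s1 0 = s 0 by rewrite /s1 /upd K0.
pose s3 := upd s2 K.+1 (s2 0).
have e2 : s2 K = s 0 by rewrite h4 // /s1 /upd eqxx.
pose s4 := upd s3 0 (s3 K).
have e4 : s4 0 = s 0.
  by rewrite /s4 /upd eqxx /s3 /upd (_ : (K == K.+1) = false) ?e2 //; apply/negP=> /eqP; lia.
have [t2 [s5 [k1 k2 k3 k4]]] := cg s4.
have e5 : s5 K.+1 = f (s 0).
  by rewrite k4; [rewrite /s4 /upd /= /s3 /upd eqxx h2 e1 | lia].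
exists (2 + (t1 + (2 + (2 + (t2 + 4))))), (upd s5 0 (Cons (s5 K.+1) (s5 0))); split.
- apply: (ExecSeq (s1 := s1)); first exact: ExecAssign.
  apply: ExecSeq h1 _; apply: (ExecSeq (s1 := s3)); first exact: ExecAssign.
  apply: (ExecSeq (s1 := s4)); first exact: ExecAssign.
  by apply: ExecSeq k1 _; exact: ExecAssign.
- by rewrite /upd eqxx e5 k2 e4.
- by move: h3 k3; rewrite e1 e4; lia.
- move=> y hy; rewrite /upd ifN; last by apply/eqP; lia.
  rewrite k4 ?/s4 /upd; last lia.
  rewrite ifN; last by apply/eqP; lia.
  rewrite /s3 /upd ifN; last by apply/eqP; lia.
  rewrite h4; last lia.
  by rewrite /s1 /upd ifN //; apply/eqP; lia.
Qed.

Definition tif (c a b : tree) : tree := if c is Nil then b else a.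

(** Both branches are evaluated before the test selects one, which is harmless for polynomial
    time. *)
Lemma FP_tif c f g : FP c -> FP f -> FP g -> FP (fun x => tif (c x) (f x) (g x)).
Proof.
move=> hc hf hg; apply: (FP_comp (FP_Cons hc (FP_Cons hf hg))
  (g := fun e => tif (hd e) (hd (tl e)) (tl (tl e)))).
apply: (@FP_intro _ (CIf (EHd (EVar 0)) (CAssign 0 (EHd (ETl (EVar 0))))
   (CAssign 0 (ETl (ETl (EVar 0))))) 1 id (fun=> 10)) => //.
- exact: poly_id.
- exact: poly_const.
- move=> x; rewrite /tif; case: (hd x) => [|_ _].
    exact: leq_trans (size_tl _) (size_tl _).
  exact: leq_trans (size_hd _) (size_tl _).
move=> s; case E: (hd (s 0)) => [|u v].
- exists 7, (upd s 0 (tl (tl (s 0)))); split=> //=; last by case.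
  by apply: (@ExecIfFalse _ _ _ _ _ 4) => //; apply: (@ExecAssign s 0 (ETl (ETl (EVar 0)))).
- exists 7, (upd s 0 (hd (tl (s 0)))); split=> //=; last by case.
  apply: (@ExecIfTrue _ _ _ _ _ 4); first by rewrite /= E.
  by apply: (@ExecAssign s 0 (EHd (ETl (EVar 0)))).
Qed.

Lemma FP2_comp b f g : FP2 b -> FP f -> FP g -> FP (fun x => b (f x) (g x)).
Proof. by move=> hb hf hg; apply: (FP_comp (FP_Cons hf hg) hb). Qed.

Lemma FP3_comp b f g h : FP3 b -> FP f -> FP g -> FP h ->
  FP (fun x => b (f x) (g x) (h x)).
Proof. by move=> hb hf hg hh; apply: (FP_comp (FP_Cons hf (FP_Cons hg hh)) hb). Qed.

(** * Polynomial folds over lists *)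

Fixpoint tfold (b : tree -> tree -> tree -> tree) (ctx acc l : tree) : tree :=
  if l is Cons x l' then tfold b ctx (b ctx acc x) l' else acc.

Fixpoint tlen (t : tree) : nat := if t is Cons _ t' then (tlen t').+1 else 0.

Lemma tlen_size t : tlen t < tree_size t.
Proof. by elim: t => //= a _ b; lia. Qed.

(** A fold stays polynomial when some measure [mu] of the accumulator grows
    only additively, by an amount depending on the context and on the current
    item, and controls the size of the accumulator after each step. *)
Definition growth (b : tree -> tree -> tree -> tree) : Prop :=
  exists (mu : tree -> nat) (a k : nat), [/\ forall t, mu t <= tree_size t,
    forall ctx acc e,
      mu (b ctx acc e) <= mu acc + pb a k (tree_size ctx + tree_size e) &
    forall ctx acc e, tree_size (b ctx acc e) <=
      pb a k (mu acc + tree_size ctx + tree_size e)].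

(** The measure is the tree size itself; the larger coefficient and exponent absorb the summand
    [tree_size acc] in the size bound. *)
Lemma growth_additive b p : poly p ->
  (forall ctx acc e, tree_size (b ctx acc e) <=
     tree_size acc + p (tree_size ctx + tree_size e)) -> growth b.
Proof.
move=> [a [k hp]] h; exists tree_size, a.+1, k.+1; split=> // ctx acc e.
- apply: leq_trans (h _ _ _) _; rewrite leq_add2l; apply: leq_trans (hp _) _.
  by rewrite /pb; apply: leq_mul => //; apply: leq_pexp2l.
- apply: leq_trans (h _ _ _) _; set m := tree_size ctx + _.
  rewrite -addnA -/m /pb mulSn; apply: leq_add.
    by rewrite expnS; apply: leq_trans (leq_pmulr _ _); [lia | rewrite expn_gt0].
  apply: leq_trans (hp _) _; rewrite leq_mul2l; apply/orP; right.
  apply: leq_trans (_ : (tree_size acc + m).+1 ^ k <= _); last exact: leq_pexp2l.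
  by case: (k) => // k'; rewrite leq_exp2r // ltnS leq_addl.
Qed.


Section FoldCost.
Variables (b : tree -> tree -> tree -> tree) (mu : tree -> nat) (a k : nat).
Hypothesis hmu : forall c acc e,
  mu (b c acc e) <= mu acc + pb a k (tree_size c + tree_size e).
Hypothesis hsz : forall c acc e,
  tree_size (b c acc e) <= pb a k (mu acc + tree_size c + tree_size e).
Variables (ctx : tree) (n q Z : nat).
Hypothesis hZ : pb a k (q + n) <= Z.

(** [n] bounds the context and the remaining list, [q] the measure including all growth still to
    come, and [Z] the current accumulator. *)
Definition fold_inv (acc l : tree) : Prop :=
  [/\ tree_size acc <= Z, mu acc + tlen l * pb a k n <= q
    & tree_size ctx + tree_size l <= n].

Lemma fold_inv_step acc x l :
  fold_inv acc (Cons x l) -> fold_inv (b ctx acc x) l.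
Proof.
move=> [_ h2 h3]; have h1 : pb a k (tree_size ctx + tree_size x) <= pb a k n.
  by apply: leq_pb; move: h3 => /=; lia.
move: (hmu ctx acc x) h2 h3; rewrite /= mulSn => h4 h5 h6; split; try lia.
apply: leq_trans hZ; apply: leq_trans (hsz _ _ _) _; apply: leq_pb; lia.
Qed.

Lemma tfold_size acc l : fold_inv acc l -> tree_size (tfold b ctx acc l) <= Z.
Proof.
elim: l acc => [|x _ l IH] acc; first by case.
by move/fold_inv_step/IH.
Qed.

Variables (c : cmd) (N a' k' : nat).
Hypothesis N0 : 0 < N.
Hypothesis cb :
  computes c N (fun e => b (hd e) (hd (tl e)) (tl (tl e)))
    (fun x => pb a' k' (tree_size x)).

Lemma tfold_exec l s : s N = ctx -> s N.+1 = l -> fold_inv (s 0) l ->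
  exists t s',
    [/\ exec (CWhile (EVar N.+1)
            (CSeq (CAssign 0 (ECons (EVar N) (ECons (EVar 0) (EHd (EVar N.+1)))))
               (CSeq c (CAssign N.+1 (ETl (EVar N.+1)))))) s t s',
        s' 0 = tfold b ctx (s 0) l,
        t <= tlen l * (pb a' k' (n + Z + 2) + 12) + 2
      & forall y, N.+2 <= y -> s' y = s y].
Proof.
elim: l s => [|x _ l IH] s sN sl hinv.
  by exists 2, s; split=> //; apply: (@ExecWhileFalse (EVar N.+1)).
pose s1 := upd s 0 (Cons ctx (Cons (s 0) x)).
have [t1 [s2 [h1 h2 h3 h4]]] := cb s1.
pose s3 := upd s2 N.+1 l.
have e1 : s1 0 = Cons ctx (Cons (s 0) x) by rewrite /s1 /upd eqxx.
have e3 : s3 0 = b ctx (s 0) x by rewrite /s3 /upd /= h2 e1.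
have e3N : s3 N = ctx.
  rewrite /s3 /upd ifN; last by apply/eqP; lia.
  rewrite h4 // /s1 /upd ifN //; by apply/eqP; lia.
have e3l : s3 N.+1 = l by rewrite /s3 /upd eqxx.
have i3 : fold_inv (s3 0) l by rewrite e3; apply: fold_inv_step.
have [t2 [s4 [k1 k2 k3 k4]]] := IH s3 e3N e3l i3.
exists (1 + (7 + (t1 + 3)) + t2).+1, s4; split.
- apply: ExecWhileTrue k1; first by rewrite /= sl.
  apply: (ExecSeq (s1 := s1)).
    rewrite /s1 -[in X in upd _ _ X]sN -[x]/(hd (Cons x l)) -sl.
    exact: (@ExecAssign s 0 (ECons (EVar N) (ECons (EVar 0) (EHd (EVar N.+1))))).
  apply: ExecSeq h1 _.
  have -> : s3 = upd s2 N.+1 (eval s2 (ETl (EVar N.+1))).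
    by rewrite /s3 /= h4 // /s1 /upd /= -/upd sl.
  exact: ExecAssign.
- by rewrite k2 e3.
- have : t1 <= pb a' k' (n + Z + 2).
    apply: leq_trans h3 _; apply: leq_pb; rewrite e1 /=.
    by case: hinv => /= ? ? ?; lia.
  by move: k3; rewrite /= mulSn; lia.
- move=> y hy; rewrite k4 // /s3 /upd ifN; last by apply/eqP; lia.
  rewrite h4; last lia.
  by rewrite /s1 /upd ifN //; apply/eqP; lia.
Qed.

End FoldCost.

Lemma FP_tfold b : FP3 b -> growth b -> FP3 (tfold b).
Proof.
move=> [c [N [a' [k' [N0 _ cb]]]]] [mu [a [k [mus hmu hsz]]]].
(* [Q] is the initial measure plus the growth over [n] rounds. The first summand of [Z] covers the
   initial accumulator, whose size the step bound does not control. *)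
pose Q n := n + n * pb a k n; pose Z n := n + pb a k (Q n + n).
have polyQ : poly Q.
  by rewrite /Q; poly_tac.
have polyZ : poly Z.
  by rewrite /Z; poly_tac.
pose prog := CSeq (CAssign N (EHd (EVar 0))) (CSeq (CAssign N.+1 (ETl (ETl (EVar 0))))
  (CSeq (CAssign 0 (EHd (ETl (EVar 0)))) (CWhile (EVar N.+1)
   (CSeq (CAssign 0 (ECons (EVar N) (ECons (EVar 0) (EHd (EVar N.+1)))))
               (CSeq c (CAssign N.+1 (ETl (EVar N.+1)))))))).
(* The slack 2 serves [x = Nil], whose three projections are all [Nil] and have total size 3. *)
have inv0 x : fold_inv mu a k (hd x) (tree_size x + 2) (Q (tree_size x + 2)) (Z (tree_size x + 2))
    (hd (tl x)) (tl (tl x)).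
  set n := tree_size x + 2.
  have hs : tree_size (hd x) + tree_size (hd (tl x)) + tree_size (tl (tl x)) <= n.
    by rewrite /n; case: x {n} => [|u [|v w]] //=; lia.
  split.
  - by rewrite /Z; lia.
  - rewrite /Q; apply: leq_add.
      by apply: leq_trans (mus _) _; lia.
    rewrite leq_mul2r; apply/orP; right.
    by apply: leq_trans (ltnW (tlen_size _)) _; lia.
  - by lia.
have hZ n : pb a k (Q n + n) <= Z n by rewrite leq_addl.
apply: (@FP_intro _ prog N.+2 (fun n => Z (n + 2))
  (fun n => (n + 2) * (pb a' k' (n + 2 + Z (n + 2) + 2) + 12) + 15)) => //.
- have [A [K h]] := polyZ; apply: (@poly_le _ (fun n => pb A K (n + 2))) => // .
  by poly_tac.
- have [A [K h]] := polyZ.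
  apply: (@poly_le _ (fun n => (n + 2) * (pb a' k' (n + 2 + pb A K (n + 2) + 2) + 12) + 15)).
    move=> n; rewrite leq_add2r leq_mul2l; apply/orP; right; rewrite leq_add2r.
    by apply: leq_pb; rewrite leq_add2r leq_add2l.
  by poly_tac.
- move=> x; exact: (tfold_size hmu hsz (hZ _) (inv0 x)).
move=> s; set x := s 0.
pose s1 := upd s N (hd x); pose s2 := upd s1 N.+1 (tl (tl x)).
pose s3 := upd s2 0 (hd (tl x)).
have n0 : (0 == N) = false by apply/negP=> /eqP; lia.
have e1 : s1 0 = x by rewrite /s1 /upd n0.
have e2 : s2 0 = x by rewrite /s2 /upd /= e1.
have e3 : s3 0 = hd (tl x) by rewrite /s3 /upd eqxx.
have e3N : s3 N = hd x.
  rewrite /s3 /upd eq_sym n0 /s2 /upd ifN; last by apply/eqP; lia.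
  by rewrite /s1 /upd eqxx.
have e3l : s3 N.+1 = tl (tl x) by rewrite /s3 /upd /= /s2 /upd eqxx.
have i3 := inv0 x; rewrite -e3 in i3.
have [t [s' [h1 h2 h3 h4]]] := tfold_exec hmu hsz (hZ _) N0 cb e3N e3l i3.
exists (3 + (4 + (4 + t))), s'; split.
- apply: (ExecSeq (s1 := s1)); first exact: (@ExecAssign s N (EHd (EVar 0))).
  apply: (ExecSeq (s1 := s2)).
    rewrite /s2 -e1; exact: (@ExecAssign s1 N.+1 (ETl (ETl (EVar 0)))).
  apply: ExecSeq h1; rewrite /s3 -e2; exact: (@ExecAssign s2 0 (EHd (ETl (EVar 0)))).
- by rewrite h2 e3.
- have : tlen (tl (tl x)) <= tree_size x + 2.
    apply: leq_trans (ltnW (tlen_size _)) _; apply: leq_trans (size_tl _) _.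
    by apply: leq_trans (size_tl _) _; lia.
  move: h3; set P := pb a' k' _; set L := tlen _ => h3 h5.
  have : L * (P + 12) <= (tree_size x + 2) * (P + 12) by rewrite leq_mul2r h5 orbT.
  lia.
- move=> y hy; rewrite h4 // /s3 /upd ifN; last by apply/eqP; lia.
  rewrite /s2 /upd ifN; last by apply/eqP; lia.
  by rewrite /s1 /upd ifN //; apply/eqP; lia.
Qed.

(** * Lists and bit vectors *)

Create HintDb fp discriminated.
#[local] Hint Constants Opaque : fp.
#[local] Hint Resolve FP_id FP_const FP_hd FP_tl FP_Cons FP_tif : fp.

Ltac fp := rewrite /FP2 /FP3 /=; auto 30 with fp.

Lemma FP_fold b f g h : FP3 b -> growth b -> FP f -> FP g -> FP h ->
  FP (fun x => tfold b (f x) (g x) (h x)).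
Proof. by move=> hb gb; apply/FP3_comp/FP_tfold. Qed.

Lemma FP2_size f : FP2 f -> exists a k, forall x y,
  tree_size (f x y) <= pb a k (tree_size x + tree_size y + 1).
Proof. by move/FP_size=> [a [k h]]; exists a, k => x y; rewrite addn1; exact: (h (Cons x y)). Qed.

Fixpoint tseq (t : tree) : seq tree := if t is Cons x t' then x :: tseq t' else [::].

Lemma tseqK t : enc_seq id (tseq t) = t.
Proof. by elim: t => //= x _ t ->. Qed.

Lemma tlen_enc (X : Type) (f : X -> tree) s : tlen (enc_seq f s) = size s.
Proof. by elim: s => //= x s ->. Qed.

Lemma size_tseq t : size (tseq t) = tlen t.
Proof. by rewrite -[in RHS](tseqK t) tlen_enc. Qed.

Lemma eq_enc (X : eqType) (f g : X -> tree) s : {in s, f =1 g} -> enc_seq f s = enc_seq g s.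
Proof.
elim: s => //= x s IH h; rewrite h ?mem_head // IH // => y ys.
by rewrite h // inE ys orbT.
Qed.

Lemma enc_map (X Y : Type) (f : Y -> tree) (g : X -> Y) s :
  enc_seq f [seq g x | x <- s] = enc_seq (fun x => f (g x)) s.
Proof. by elim: s => //= x s ->. Qed.

Lemma tfoldE (X : Type) b c acc (f : X -> tree) s :
  tfold b c acc (enc_seq f s) = foldl (fun acc x => b c acc (f x)) acc s.
Proof. by elim: s acc => //=. Qed.

Lemma size_enc (X : Type) (f : X -> tree) s :
  tree_size (enc_seq f s) = (sumn [seq (tree_size (f x)).+1 | x <- s]).+1.
Proof. by elim: s => //= x s ->; lia. Qed.

Definition trev (l : tree) : tree := tfold (fun _ acc e => Cons e acc) Nil Nil l.

Lemma trevE (X : Type) (f : X -> tree) s : trev (enc_seq f s) = enc_seq f (rev s).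
Proof.
rewrite /trev tfoldE /rev -[Nil]/(enc_seq f [::]).
by elim: s [::] => //= x s IH acc; rewrite -IH.
Qed.

Lemma FP_trev f : FP f -> FP (fun x => trev (f x)).
Proof.
move=> hf; apply: FP_fold => //; try by fp.
by apply: (growth_additive (poly_add poly_id (poly_const 1))) => ctx acc e /=; lia.
Qed.
#[local] Hint Resolve FP_trev : fp.

Lemma trevK t : trev (trev t) = t.
Proof. by rewrite -(tseqK t) !trevE revK. Qed.

Definition tapp (a b : tree) : tree := tfold (fun _ acc e => Cons e acc) Nil b (trev a).

Lemma tappE (X : Type) (f : X -> tree) s t :
  tapp (enc_seq f s) (enc_seq f t) = enc_seq f (s ++ t).
Proof.
rewrite /tapp trevE tfoldE foldl_rev.
by elim: s => //= x s ->.
Qed.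

Lemma FP_tapp f g : FP f -> FP g -> FP (fun x => tapp (f x) (g x)).
Proof.
move=> hf hg; apply: FP_fold => //; try by fp.
by apply: (growth_additive (poly_add poly_id (poly_const 1))) => ctx acc e /=; lia.
Qed.
#[local] Hint Resolve FP_tapp : fp.

Lemma size_tapp a b : (tree_size (tapp a b)).+1 = tree_size a + tree_size b.
Proof.
by rewrite -(tseqK a) -(tseqK b) tappE !size_enc map_cat sumn_cat; lia.
Qed.

Lemma tlen_tapp a b : tlen (tapp a b) = tlen a + tlen b.
Proof. by rewrite -(tseqK a) -(tseqK b) tappE !tlen_enc size_cat. Qed.

(** The fold conses its results in reverse order, whence the final [trev]. *)
Definition tmap (f : tree -> tree -> tree) (ctx l : tree) : tree :=
  trev (tfold (fun c acc e => Cons (f c e) acc) ctx Nil l).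

Lemma tmapE (X : Type) g c (f : X -> tree) s :
  tmap g c (enc_seq f s) = enc_seq (fun x => g c (f x)) s.
Proof.
rewrite /tmap tfoldE -[RHS]trevK trevE; congr trev.
rewrite -{1}(revK s) foldl_rev.
by elim: (rev s) => //= x r ->.
Qed.

Lemma FP_tmap b f g : FP2 b -> FP f -> FP g -> FP (fun x => tmap b (f x) (g x)).
Proof.
move=> hb hf hg; apply: FP_trev; apply: FP_fold => //; try by fp.
- apply: FP_Cons; last by fp.
  by apply: (FP2_comp hb); fp.
have [a [k h]] := FP2_size hb.
apply: (@growth_additive _ (fun n => pb a k (n + 1) + 1)); first by poly_tac.
by move=> ctx acc e /=; move: (h ctx e); lia.
Qed.

Lemma tlen_tmap b c t : tlen (tmap b c t) = tlen t.
Proof. by rewrite -(tseqK t) tmapE !tlen_enc. Qed.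

Definition tflat (l : tree) : tree := tfold (fun _ acc e => tapp acc e) Nil Nil l.

Lemma tflatE (X Y : Type) (g : Y -> tree) (F : X -> seq Y) s :
  tflat (enc_seq (fun x => enc_seq g (F x)) s) = enc_seq g (flatten [seq F x | x <- s]).
Proof.
rewrite /tflat tfoldE -[flatten _]/([::] ++ flatten _) -[X in foldl _ X]/(enc_seq g [::]).
elim: s [::] => [|x s IH] r /=; first by rewrite cats0.
by rewrite tappE IH catA.
Qed.

Lemma FP_tflat f : FP f -> FP (fun x => tflat (f x)).
Proof.
move=> hf; apply: FP_fold => //; try by fp.
by apply: (growth_additive poly_id) => ctx acc e; move: (size_tapp acc e); lia.
Qed.

Definition tprod (a b : tree) : tree :=
  tflat (tmap (fun b x => tmap (fun x y => Cons x y) x b) b a).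

Lemma tprodE (X Y : Type) (f : X -> tree) (g : Y -> tree) s t :
  tprod (enc_seq f s) (enc_seq g t) =
  enc_seq (fun p => Cons (f p.1) (g p.2)) [seq (x, y) | x <- s, y <- t].
Proof.
rewrite /tprod tmapE.
rewrite -(@tflatE _ _ _ (fun x => [seq (x, y) | y <- t])); congr tflat.
by elim: s => //= x s ->; rewrite tmapE enc_map.
Qed.

Lemma FP_tprod f g : FP f -> FP g -> FP (fun x => tprod (f x) (g x)).
Proof.
move=> hf hg; apply: FP_tflat; apply: FP_tmap => //.
by apply: FP_tmap; fp.
Qed.
#[local] Hint Resolve FP_tflat FP_tprod : fp.

(** The accumulator pairs the reversed output with the unread rest of [b]; since [hd] and [tl] of
    [Nil] are [Nil], a short [b] is padded with [Nil]. *)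
Definition tzip (a b : tree) : tree :=
  trev (hd (tfold (fun _ acc e => Cons (Cons (Cons e (hd (tl acc))) (hd acc)) (tl (tl acc)))
    Nil (Cons Nil b) a)).

(** Structural counterpart of [tzip], convenient for induction. *)
Fixpoint rzip (a b : tree) : tree :=
  if a is Cons x a' then Cons (Cons x (hd b)) (rzip a' (tl b)) else Nil.

Lemma trev_fold out t :
  tfold (fun _ acc e => Cons e acc) Nil out t = tapp (trev t) out.
Proof. by rewrite /tapp trevK. Qed.

Lemma tapp_Nil t : tapp t Nil = t.
Proof. by rewrite /tapp -/(trev _) trevK. Qed.

Lemma tzipr a b : tzip a b = rzip a b.
Proof.
rewrite /tzip -[RHS]trevK; congr trev.
suff h out : hd (tfold (fun _ acc e =>
    Cons (Cons (Cons e (hd (tl acc))) (hd acc)) (tl (tl acc))) Nil (Cons out b) a)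
  = tfold (fun _ acc e => Cons e acc) Nil out (rzip a b) by exact: h.
by elim: a b out => //= x _ a IH b out; rewrite IH.
Qed.

Lemma tzipE (X : Type) (f g : X -> tree) s :
  tzip (enc_seq f s) (enc_seq g s) = enc_seq (fun x => Cons (f x) (g x)) s.
Proof. by rewrite tzipr; elim: s => //= x s ->. Qed.

Lemma tlen_tzip a b : tlen (tzip a b) = tlen a.
Proof. by rewrite tzipr; elim: a b => //= x _ a IH b; rewrite IH. Qed.

Lemma FP_tzip f g : FP f -> FP g -> FP (fun x => tzip (f x) (g x)).
Proof.
move=> hf hg; apply/FP_trev/FP_hd/FP_fold; try by fp.
apply: (@growth_additive _ (fun n => n + 10)); first by poly_tac.
by move=> ctx acc e /=; case: acc => [|u [|v w]] /=; lia.
Qed.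
#[local] Hint Resolve FP_tzip : fp.

(** * Booleans and bit vectors *)

Definition tt : tree := enc_bool true.
Definition bit (t : tree) : bool := if t is Nil then false else true.
Definition tnot a := tif a Nil tt.
Definition tand a b := tif a (tif b tt Nil) Nil.
Definition tor a b := tif a tt (tif b tt Nil).
Definition txor a b := tif a (tnot b) (tif b tt Nil).
Definition tmaj a b c := tif a (tor b c) (tand b c).

Lemma bit_enc b : bit (enc_bool b) = b. Proof. by case: b. Qed.
Lemma tifE c a b : tif c a b = if bit c then a else b. Proof. by case: c. Qed.
Lemma tnotE a : tnot a = enc_bool (~~ bit a). Proof. by case: a. Qed.
Lemma tandE a b : tand a b = enc_bool (bit a && bit b). Proof. by case: a; case: b. Qed.
Lemma torE a b : tor a b = enc_bool (bit a || bit b). Proof. by case: a; case: b. Qed.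
Lemma txorE a b : txor a b = enc_bool (bit a (+) bit b). Proof. by case: a; case: b. Qed.
Lemma tmajE a b c : tmaj a b c =
  enc_bool (if bit a then bit b || bit c else bit b && bit c).
Proof. by case: a; case: b; case: c. Qed.

Lemma FP_tnot f : FP f -> FP (fun x => tnot (f x)).
Proof. by move=> hf; rewrite /tnot; fp. Qed.
Lemma FP_tand f g : FP f -> FP g -> FP (fun x => tand (f x) (g x)).
Proof. by move=> hf hg; rewrite /tand; fp. Qed.
Lemma FP_tor f g : FP f -> FP g -> FP (fun x => tor (f x) (g x)).
Proof. by move=> hf hg; rewrite /tor; fp. Qed.
#[local] Hint Resolve FP_tnot FP_tand FP_tor : fp.
Lemma FP_txor f g : FP f -> FP g -> FP (fun x => txor (f x) (g x)).
Proof. by move=> hf hg; rewrite /txor; fp. Qed.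
Lemma FP_tmaj f g h : FP f -> FP g -> FP h -> FP (fun x => tmaj (f x) (g x) (h x)).
Proof. by move=> hf hg hh; rewrite /tmaj; fp. Qed.
#[local] Hint Resolve FP_txor FP_tmaj : fp.

Lemma size_enc_bool b : tree_size (enc_bool b) <= 3. Proof. by case: b. Qed.

Lemma size_bits (X : Type) (f : X -> bool) s :
  tree_size (enc_seq (fun x => enc_bool (f x)) s) <= 4 * size s + 1.
Proof. by elim: s => //= x s; move: (size_enc_bool (f x)); lia. Qed.

Definition tall (p : tree -> tree -> tree) (ctx l : tree) : tree :=
  tfold (fun c acc e => tand acc (p c e)) ctx tt l.

Lemma tallE (X : Type) p c (f : X -> tree) s :
  tall p c (enc_seq f s) = enc_bool (all (fun x => bit (p c (f x))) s).
Proof.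
rewrite /tall tfoldE -[tt]/(enc_bool true) -[all _ _]andTb.
by elim: s true => [|x s IH] b /=; rewrite ?andbT // tandE bit_enc IH andbA.
Qed.

Lemma FP_tall p f g : FP2 p -> FP f -> FP g -> FP (fun x => tall p (f x) (g x)).
Proof.
move=> hp hf hg; apply: FP_fold => //; try by fp.
- by apply: FP_tand; [fp | apply: (FP2_comp hp); fp].
apply: (growth_additive (poly_const 3)) => ctx acc e.
by rewrite tandE; move: (size_enc_bool (bit acc && bit (p ctx e))); lia.
Qed.

Definition bvor (a b : tree) := tmap (fun _ e => tor (hd e) (tl e)) Nil (tzip a b).
Definition bvand (a b : tree) := tmap (fun _ e => tand (hd e) (tl e)) Nil (tzip a b).
Definition bvsub (a b : tree) := tall (fun _ e => tor (tnot (hd e)) (tl e)) Nil (tzip a b).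

(** [trim a b]: [b] cut or padded with zeros to the length of [a]. *)
Definition trim (a b : tree) := tmap (fun _ e => tif (tl e) tt Nil) Nil (tzip a b).

Lemma FP_bvor f g : FP f -> FP g -> FP (fun x => bvor (f x) (g x)).
Proof. by move=> hf hg; apply: FP_tmap; fp. Qed.
Lemma FP_bvand f g : FP f -> FP g -> FP (fun x => bvand (f x) (g x)).
Proof. by move=> hf hg; apply: FP_tmap; fp. Qed.
Lemma FP_bvsub f g : FP f -> FP g -> FP (fun x => bvsub (f x) (g x)).
Proof. by move=> hf hg; apply: FP_tall; fp. Qed.
Lemma FP_trim f g : FP f -> FP g -> FP (fun x => trim (f x) (g x)).
Proof. by move=> hf hg; apply: FP_tmap; fp. Qed.
#[local] Hint Resolve FP_bvor FP_bvand FP_bvsub FP_trim : fp.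

Lemma size_trim a b : tree_size (trim a b) <= 4 * tlen a + 1.
Proof.
rewrite /trim -(tlen_tzip a b) -(tseqK (tzip a b)) tmapE tlen_enc.
rewrite (_ : enc_seq _ _ = enc_seq (fun x => enc_bool (bit (tl x))) (tseq (tzip a b))).
  exact: size_bits.
by elim: (tseq _) => //= x s ->; case: (tl x).
Qed.

Lemma size_bvor a b : tree_size (bvor a b) <= 4 * tlen a + 1.
Proof.
rewrite /bvor -(tlen_tzip a b) -(tseqK (tzip a b)) tmapE tlen_enc.
rewrite (_ : enc_seq _ _ =
  enc_seq (fun x => enc_bool (bit (hd x) || bit (tl x))) (tseq (tzip a b))).
  exact: size_bits.
by elim: (tseq _) => //= x s ->; rewrite torE.
Qed.

(** * Binary arithmetic *)

Fixpoint val (t : tree) : nat := if t is Cons x t' then bit x + 2 * val t' else 0.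

Lemma val_lt t : val t < 2 ^ tlen t.
Proof. by elim: t => //= x _ t IH; rewrite expnS; case: (bit x) => /=; lia. Qed.

Lemma valE t : val t = bit (hd t) + 2 * val (tl t).
Proof. by case: t. Qed.

(** Ripple-carry addition and subtraction. The result has as many digits as
    the list [F], whose items are irrelevant. *)
Definition add_step (c acc e : tree) : tree :=
  let x := hd (hd (tl acc)) in let y := hd (hd (tl (tl acc))) in
  Cons (tmaj (hd acc) x y) (Cons (tl (hd (tl acc))) (Cons (tl (hd (tl (tl acc))))
    (Cons (txor (hd acc) (txor x y)) (tl (tl (tl acc)))))).

(** The carry slot now holds a borrow, the majority taken with the digit of the minuend
    complemented. The output digit is the same exclusive or as for addition. *)
Definition sub_step (c acc e : tree) : tree :=
  let x := hd (hd (tl acc)) in let y := hd (hd (tl (tl acc))) in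
  Cons (tmaj (hd acc) (tnot x) y) (Cons (tl (hd (tl acc))) (Cons (tl (hd (tl (tl acc))))
    (Cons (txor (hd acc) (txor x y)) (tl (tl (tl acc)))))).

Definition taddw (F a b : tree) : tree :=
  trev (tl (tl (tl (tfold add_step Nil (Cons Nil (Cons a (Cons b Nil))) F)))).

Definition tsubw (F a b : tree) : tree :=
  tfold sub_step Nil (Cons Nil (Cons a (Cons b Nil))) F.

Definition tsub (a b : tree) : tree := trev (tl (tl (tl (tsubw a a b)))).
(** The borrow left by [a - b], at a width covering both operands. *)
Definition tlt (a b : tree) : tree := hd (tsubw (tapp a b) a b).

Lemma FP_add_fold f g : FP f -> FP g -> FP (fun x => tfold add_step Nil (f x) (g x)).
Proof.
move=> hf hg; apply: FP_fold => //; rewrite /add_step; try by fp.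
apply: (growth_additive (poly_const 30)) => ctx acc e.
rewrite tmajE !txorE; case: acc => [|u [|v [|w z]]] /=;
  have h := size_enc_bool;
  repeat match goal with |- context [enc_bool ?b] => move: (h b); move: (enc_bool b) => ? end;
  try case: v => [|? ?] /=; try case: w => [|? ?] /=; lia.
Qed.
Lemma FP_sub_fold f g : FP f -> FP g -> FP (fun x => tfold sub_step Nil (f x) (g x)).
Proof.
move=> hf hg; apply: FP_fold => //; rewrite /sub_step; try by fp.
apply: (growth_additive (poly_const 30)) => ctx acc e.
rewrite tmajE !txorE; case: acc => [|u [|v [|w z]]] /=;
  have h := size_enc_bool;
  repeat match goal with |- context [enc_bool ?b] => move: (h b); move: (enc_bool b) => ? end;
  try case: v => [|? ?] /=; try case: w => [|? ?] /=; lia.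
Qed.
#[local] Hint Resolve FP_add_fold FP_sub_fold : fp.

Lemma FP_taddw f g h : FP f -> FP g -> FP h -> FP (fun x => taddw (f x) (g x) (h x)).
Proof. by move=> hf hg hh; rewrite /taddw; fp. Qed.
Lemma FP_tsub f g : FP f -> FP g -> FP (fun x => tsub (f x) (g x)).
Proof. by move=> hf hg; rewrite /tsub /tsubw; fp. Qed.
Lemma FP_tlt f g : FP f -> FP g -> FP (fun x => tlt (f x) (g x)).
Proof. by move=> hf hg; rewrite /tlt /tsubw; fp. Qed.
#[local] Hint Resolve FP_taddw FP_tsub FP_tlt : fp.

Fixpoint tdrop (F a : tree) : tree := if F is Cons _ F' then tdrop F' (tl a) else a.

Lemma tdrop_Nil F a : tlen a <= tlen F -> tdrop F a = Nil.
Proof. by elim: F a => [|x _ F IH] [|y a] //= h; apply: IH. Qed.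

(** A full adder conserves value, so the identity follows digit by digit. It holds at any width [F],
    overflow being recorded in the carry and in the unread digits. *)
Lemma tfold_add F c a b out : exists c' r,
  [/\ tfold add_step Nil (Cons c (Cons a (Cons b out))) F =
      Cons c' (Cons (tdrop F a) (Cons (tdrop F b)
        (tapp (trev (enc_seq enc_bool r)) out))),
      size r = tlen F &
      val (enc_seq enc_bool r) + 2 ^ tlen F * (bit c' + val (tdrop F a) + val (tdrop F b))
      = bit c + val a + val b].
Proof.
elim: F c a b out => [|x _ F IH] c a b out /=.
  by exists c, [::]; rewrite /= expn0 mul1n add0n.
have [c' [r [h1 h2 h3]]] := IH (tmaj c (hd a) (hd b)) (tl a) (tl b)
  (Cons (txor c (txor (hd a) (hd b))) out).
rewrite {1}/add_step /= h1; exists c', ((bit c (+) (bit (hd a) (+) bit (hd b))) :: r).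
split.
- by rewrite -!trev_fold /= !txorE bit_enc.
- by rewrite /= h2.
- rewrite /= bit_enc (valE a) (valE b) expnS.
  move: h3; rewrite tmajE bit_enc -mulnA.
  by case: (bit c); case: (bit (hd a)); case: (bit (hd b)) => /= h3; lia.
Qed.

(** The conservation law of a subtractor, with the borrow moved to the left side to avoid truncated
    subtraction. Only the empty [F] leaves the borrow [c] as given; every step normalises it to a
    Boolean. *)
Lemma tfold_sub F c a b out : exists c' r,
  [/\ tfold sub_step Nil (Cons c (Cons a (Cons b out))) F =
      Cons (if F is Nil then c else enc_bool c') (Cons (tdrop F a) (Cons (tdrop F b)
        (tapp (trev (enc_seq enc_bool r)) out))),
      size r = tlen F, (F = Nil -> c' = bit c) &
      val a + 2 ^ tlen F * (c' + val (tdrop F b))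
      = val (enc_seq enc_bool r) + val b + bit c + 2 ^ tlen F * val (tdrop F a)].
Proof.
elim: F c a b out => [|x _ F IH] c a b out /=.
  by exists (bit c), [::]; rewrite /= expn0; split=> //; lia.
have [c' [r [h1 h2 h4 h3]]] := IH (tmaj c (tnot (hd a)) (hd b)) (tl a) (tl b)
  (Cons (txor c (txor (hd a) (hd b))) out).
rewrite {1}/sub_step /= h1; exists c', ((bit c (+) (bit (hd a) (+) bit (hd b))) :: r).
split=> //.
- rewrite -!trev_fold /= !txorE bit_enc; congr Cons.
  by case: F h4 {IH h1 h2 h3} => // ->; rewrite // tmajE bit_enc.
- by rewrite /= h2.
- rewrite /= bit_enc (valE a) (valE b) expnS.
  move: h3; rewrite tmajE tnotE !bit_enc -!mulnA.
  by case: (bit c); case: (bit (hd a)); case: (bit (hd b)) => /= h3; lia.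
Qed.

Lemma taddwE F a b : exists r,
  [/\ taddw F a b = enc_seq enc_bool r, size r = tlen F &
      val a + val b < 2 ^ tlen F -> val (taddw F a b) = val a + val b].
Proof.
have [c [r [h1 h2 h3]]] := tfold_add F Nil a b Nil; exists r.
have e : taddw F a b = enc_seq enc_bool r by rewrite /taddw h1 /= tapp_Nil trevK.
rewrite e; split=> //= h; move: h3 h => /=.
by case: (bit c + _ + _) => [|m]; rewrite ?mulnS; lia.
Qed.

Lemma tlen_taddw F a b : tlen (taddw F a b) = tlen F.
Proof. by have [r [-> <- _]] := taddwE F a b; rewrite tlen_enc. Qed.

Lemma size_taddw F a b : tree_size (taddw F a b) <= 4 * tlen F + 1.
Proof. by have [r [-> <- _]] := taddwE F a b; apply: (size_bits id). Qed.

Lemma tsubE a b : exists r,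
  [/\ tsub a b = enc_seq enc_bool r, size r = tlen a &
      val b <= val a -> val (tsub a b) = val a - val b].
Proof.
have [c [r [h1 h2 _ h3]]] := tfold_sub a Nil a b Nil; exists r.
have e : tsub a b = enc_seq enc_bool r by rewrite /tsub /tsubw h1 /= tapp_Nil trevK.
rewrite e; split=> //= h; move: h3; rewrite /= (tdrop_Nil (leqnn _)) /=.
(* The output digits stay below [2 ^ tlen a], so when [val b <= val a] the borrow and the unread
   part of [b] must have value zero. *)
have := val_lt (enc_seq enc_bool r); rewrite tlen_enc h2.
by move: h; clear; case: (c + _) => [|m]; rewrite ?mulnS; lia.
Qed.

Lemma tlen_tsub a b : tlen (tsub a b) = tlen a.
Proof. by have [r [-> <- _]] := tsubE a b; rewrite tlen_enc. Qed.

Lemma size_tsub a b : tree_size (tsub a b) <= 4 * tlen a + 1.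
Proof. by have [r [-> <- _]] := tsubE a b; apply: (size_bits id). Qed.

Lemma tltE a b : tlt a b = enc_bool (val a < val b).
Proof.
have [c [r [h1 h2 h4 h3]]] := tfold_sub (tapp a b) Nil a b Nil.
rewrite /tlt /tsubw h1 /=.
have -> : (if tapp a b is Nil then Nil else enc_bool c) = enc_bool c.
  by case: (tapp a b) h4 => // ->.
congr enc_bool; move: h3; rewrite !tdrop_Nil ?tlen_tapp ?leq_addr ?leq_addl //=.
have := val_lt (enc_seq enc_bool r); rewrite tlen_enc h2 tlen_tapp.
by clear; case: c; lia.
Qed.

(** This width is generous, but it makes the digit count additive, as needed when sums are
    accumulated in a fold. *)
Definition tadd (a b : tree) : tree := taddw (Cons Nil (tapp a b)) a b.

Lemma tlen_tadd a b : tlen (tadd a b) = (tlen a + tlen b).+1.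
Proof. by rewrite tlen_taddw /= tlen_tapp. Qed.

Lemma val_tadd a b : val (tadd a b) = val a + val b.
Proof.
have [r [_ _ ->]] := taddwE (Cons Nil (tapp a b)) a b => //=.
rewrite tlen_tapp expnS expnD.
have := val_lt a; have := val_lt b.
by have := expn_gt0 2 (tlen a); have := expn_gt0 2 (tlen b); nia.
Qed.

Lemma FP_tadd f g : FP f -> FP g -> FP (fun x => tadd (f x) (g x)).
Proof. by move=> hf hg; rewrite /tadd; fp. Qed.
#[local] Hint Resolve FP_tadd : fp.

(** Horner's scheme from the most significant digit of [a]: [Cons Nil acc] doubles, and the starting
    accumulator is zero at the full width [tapp a b]. *)
Definition tmul (a b : tree) : tree :=
  tfold (fun c acc e => taddw (hd c) (tif e (tl c) Nil) (Cons Nil acc))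
    (Cons (tapp a b) b) (trim (tapp a b) Nil) (trev a).

Lemma FP_tmul f g : FP f -> FP g -> FP (fun x => tmul (f x) (g x)).
Proof.
move=> hf hg; apply: FP_fold; try by fp.
apply: (@growth_additive _ (fun n => 4 * n + 1)); first by poly_tac.
move=> ctx acc e; apply: leq_trans (size_taddw _ _ _) _.
by move: (tlen_size (hd ctx)) (size_hd ctx); lia.
Qed.
#[local] Hint Resolve FP_tmul : fp.

Lemma tmulE a b : tlen (tmul a b) = tlen a + tlen b /\ val (tmul a b) = val a * val b.
Proof.
set F := tapp a b.
have vF : val (trim F Nil) = 0.
  rewrite /trim tzipr -[rzip _ _]tseqK tmapE /=.
  by elim: F => //= x _ G IH; rewrite IH.
have key s : val (enc_seq id s) * val b < 2 ^ tlen F ->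
  let r := foldr (fun e acc => taddw F (tif e b Nil) (Cons Nil acc)) (trim F Nil) s in
  tlen r = tlen F /\ val r = val (enc_seq id s) * val b.
  elim: s => [|x s IH] /= h; first by rewrite vF tlen_tmap tlen_tzip.
  rewrite tlen_taddw; split=> //.
  have h' : val (enc_seq id s) * val b < 2 ^ tlen F by nia.
  have [_ IH2] := IH h'.
  set acc := foldr _ _ s in IH2 *.
  have [r [_ _ ->]] := taddwE F (tif x b Nil) (Cons Nil acc);
    by rewrite /= IH2 tifE; case: (bit x) h => /=; nia.
have := key (tseq a); rewrite tseqK /tmul -/F -[in trev a](tseqK a) trevE tfoldE foldl_rev.
rewrite tlen_tapp /=; apply.
by rewrite expnD; have := val_lt a; have := val_lt b; nia.
Qed.

Lemma size_tmul a b : tree_size (tmul a b) <= 4 * (tlen a + tlen b) + 1.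
Proof.
rewrite /tmul -{3}(tseqK a) trevE tfoldE foldl_rev /= -tlen_tapp.
case: (tseq a) => [|x s] /=; first exact: size_trim.
exact: size_taddw.
Qed.

(** * Sums, products and minima of weights *)

Definition twt (X W : tree) : tree :=
  tfold (fun _ acc e => tadd acc (tif (hd e) (tl e) Nil)) Nil Nil (tzip X W).

(** The fold measure is the number of digits, which [tadd] merely adds up; the bound on the tree
    size of a sum carries a factor 4 that would compound over the fold. *)
Lemma FP_twt f g : FP f -> FP g -> FP (fun x => twt (f x) (g x)).
Proof.
move=> hf hg; apply: FP_fold; try by fp.
exists tlen, 20, 1; split.
- by move=> t; apply/ltnW/tlen_size.
- move=> ctx acc e; rewrite tlen_tadd tifE /pb expn1.
  by move: (tlen_size (tl e)) (size_tl e); case: (bit _) => /=; lia.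
- move=> ctx acc e; apply: leq_trans (size_taddw _ _ _) _.
  rewrite /= tlen_tapp tifE /pb expn1.
  by move: (tlen_size (tl e)) (size_tl e); case: (bit _) => /=; lia.
Qed.
#[local] Hint Resolve FP_twt : fp.

(** Product of the denominators in [W] of all positions outside [X]. *)
Definition tdens (X W : tree) : tree :=
  tfold (fun _ acc e => tmul acc (tif (hd e) (Cons tt Nil) (tl (tl e)))) Nil (Cons tt Nil)
    (tzip X W).

Lemma FP_tdens f g : FP f -> FP g -> FP (fun x => tdens (f x) (g x)).
Proof.
move=> hf hg; apply: FP_fold; try by fp.
exists tlen, 20, 1; split.
- by move=> t; apply/ltnW/tlen_size.
- move=> ctx acc e; rewrite (proj1 (tmulE _ _)) tifE /pb expn1.
  move: (tlen_size (tl (tl e))) (size_tl e) (size_tl (tl e)).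
  by case: (bit _) => /=; lia.
- move=> ctx acc e; apply: leq_trans (size_tmul _ _) _.
  rewrite tifE /pb expn1.
  move: (tlen_size (tl (tl e))) (size_tl e) (size_tl (tl e)).
  by case: (bit _) => /=; lia.
Qed.
#[local] Hint Resolve FP_tdens : fp.

(** The search starts from the total weight of all vertices, an upper bound for every single
    weight. *)
Definition tminw (X W : tree) : tree :=
  tfold (fun _ acc e => tif (tand (hd e) (tlt (tl e) acc)) (tl e) acc) Nil
    (twt (tmap (fun _ _ => tt) Nil W) W) (tzip X W).

Lemma FP_tminw f g : FP f -> FP g -> FP (fun x => tminw (f x) (g x)).
Proof.
move=> hf hg; apply: FP_fold; try by fp.
- apply: (growth_additive poly_id) => ctx acc e; rewrite tifE.
  by move: (size_tl e); case: (bit _); lia.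
- by apply: FP_twt => //; apply: FP_tmap; fp.
Qed.
#[local] Hint Resolve FP_tminw : fp.

(** * The algorithm as a tree function *)

(** A vertex is represented by the pair of its unit vector and its row of the
    adjacency matrix, so that arcs are tested without indices. *)
Definition tverts (M : tree) : tree :=
  trev (tl (tfold (fun M acc row =>
      Cons (Cons Nil (hd acc)) (Cons (Cons (trim M (hd acc)) row) (tl acc)))
    M (Cons (Cons tt Nil) Nil) M)).

Lemma FP_tverts f : FP f -> FP (fun x => tverts (f x)).
Proof.
move=> hf; apply/FP_trev/FP_tl/FP_fold; try by fp.
apply: (@growth_additive _ (fun n => 5 * n + 20)); first by poly_tac.
move=> M acc row /=; move: (size_trim M (hd acc)) (tlen_size M).
by case: acc => [|u v] /=; lia.
Qed.
#[local] Hint Resolve FP_tverts : fp.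

(** The numerator times all other denominators, that is, the weight scaled by the product of all
    denominators. *)
Definition tweights (vs W : tree) : tree :=
  tmap (fun W z => tmul (hd (tl z)) (tdens (hd (hd z)) W)) W (tzip vs W).

Lemma FP_tweights f g : FP f -> FP g -> FP (fun x => tweights (f x) (g x)).
Proof. by move=> hf hg; apply: FP_tmap; fp. Qed.
#[local] Hint Resolve FP_tweights : fp.

(** * The local ratio phase *)

Definition tarc (x y : tree) : tree := bvsub (hd y) (tl x).

Lemma FP_tarc f g : FP f -> FP g -> FP (fun x => tarc (f x) (g x)).
Proof. by move=> hf hg; rewrite /tarc; fp. Qed.
#[local] Hint Resolve FP_tarc : fp.

Definition tpat_at (v a1 a2 a3 b1 b2 b3 : tree) : tree :=
  tand (tand (tand (tarc a1 v) (tarc a2 v)) (tand (tarc a3 v) (tarc v b1)))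
  (tand (tand (tand (tarc v b2) (tarc v b3)) (tand (tarc a1 b2) (tarc a1 b3)))
  (tand (tand (tand (tarc a2 b1) (tarc a2 b3)) (tand (tarc a3 b1) (tarc a3 b2)))
        (tand (tarc b1 a1) (tand (tarc b2 a2) (tarc b3 a3))))).

Definition tpat (t : tree) : tree :=
  tpat_at (hd t) (hd (tl t)) (hd (tl (tl t))) (hd (tl (tl (tl t))))
    (hd (tl (tl (tl (tl t))))) (hd (tl (tl (tl (tl (tl t))))))
    (tl (tl (tl (tl (tl (tl t)))))).

Lemma FP_tpat f : FP f -> FP (fun x => tpat (f x)).
Proof.
move=> hf; apply: (FP_comp hf); rewrite /tpat /tpat_at.
by do ![apply: FP_tand]; apply: FP_tarc; fp.
Qed.
#[local] Hint Resolve FP_tpat : fp.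

Definition tset (t : tree) : tree :=
  bvor (hd (hd t)) (bvor (hd (hd (tl t))) (bvor (hd (hd (tl (tl t))))
  (bvor (hd (hd (tl (tl (tl t))))) (bvor (hd (hd (tl (tl (tl (tl t))))))
  (bvor (hd (hd (tl (tl (tl (tl (tl t)))))))
        (hd (tl (tl (tl (tl (tl (tl t)))))))))))).

Lemma FP_tset f : FP f -> FP (fun x => tset (f x)).
Proof. by move=> hf; apply: (FP_comp hf); rewrite /tset; fp. Qed.
#[local] Hint Resolve FP_tset : fp.

Definition treduce (m H W : tree) : tree :=
  tmap (fun m z => tsub (hd z) (tif (tl z) m Nil)) m (tzip W H).

Lemma FP_treduce f g h : FP f -> FP g -> FP h -> FP (fun x => treduce (f x) (g x) (h x)).
Proof. by move=> hf hg hh; apply: FP_tmap; fp. Qed.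
#[local] Hint Resolve FP_treduce : fp.

(** A tuple that is no pattern is reduced by [Nil], that is by zero, so the fold can run over all
    tuples. *)
Definition treduce_step (_ W t : tree) : tree :=
  treduce (tif (tpat t) (tminw (tset t) W) Nil) (tset t) W.

(** Constant throughout the local ratio phase, since [tsub] keeps the length of its first argument;
    this makes it a suitable fold measure. *)
Definition total_len (W : tree) : nat := sumn [seq (tlen w).+1 | w <- tseq W].

Lemma total_len_size W : total_len W <= tree_size W.
Proof.
rewrite -[in tree_size W](tseqK W) size_enc /total_len.
by elim: (tseq W) => //= w s; move: (tlen_size w); lia.
Qed.

Lemma map_hd_tzip (X : Type) (h : tree -> X) a b :
  [seq h (hd z) | z <- tseq (tzip a b)] = [seq h x | x <- tseq a].
Proof. by rewrite tzipr; elim: a b => //= x _ a IH b; rewrite IH. Qed.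

Lemma tseq_enc (X : Type) (f : X -> tree) s : tseq (enc_seq f s) = map f s.
Proof. by elim: s => //= x s ->. Qed.

Lemma total_len_treduce m H W : total_len (treduce m H W) = total_len W.
Proof.
rewrite /treduce /total_len -(tseqK (tzip W H)) tmapE tseq_enc -map_comp.
rewrite -(map_hd_tzip _ W H); congr sumn; apply: eq_map => z /=.
by rewrite tlen_tsub.
Qed.

Lemma size_treduce m H W : tree_size (treduce m H W) <= 4 * total_len W + 1.
Proof.
rewrite /treduce /total_len -(tseqK (tzip W H)) tmapE size_enc.
rewrite -(map_hd_tzip _ W H).
elim: (tseq _) => //= z s; move: (size_tsub (hd z) (tif (tl z) m Nil)); lia.
Qed.

Lemma FP_treduce_fold f g : FP f -> FP g -> FP (fun x => tfold treduce_step Nil (f x) (g x)).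
Proof.
move=> hf hg; apply: FP_fold => //; rewrite /treduce_step; try by fp.
exists total_len, 5, 1; split=> [t|ctx W e|ctx W e].
- exact: total_len_size.
- by rewrite total_len_treduce leq_addr.
- by apply: leq_trans (size_treduce _ _ _) _; rewrite /pb expn1; lia.
Qed.
#[local] Hint Resolve FP_treduce_fold : fp.

Definition tphase1 (vs W : tree) : tree :=
  tfold treduce_step Nil (tweights vs W)
    (tprod vs (tprod vs (tprod vs (tprod vs (tprod vs (tprod vs vs)))))).

Lemma FP_tphase1 f g : FP f -> FP g -> FP (fun x => tphase1 (f x) (g x)).
Proof. by move=> hf hg; rewrite /tphase1; fp. Qed.
#[local] Hint Resolve FP_tphase1 : fp.

(** * The dynamic programming phase *)

Definition tstates (U vs : tree) : tree :=
  tmap (fun U t => Cons (bvand (hd (hd t)) U)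
      (bvand (tl (hd t)) (bvand (tl (hd (tl t))) (bvand (tl (tl (tl t))) U))))
    U (tprod vs (tprod vs vs)).

Lemma FP_tstates f g : FP f -> FP g -> FP (fun x => tstates (f x) (g x)).
Proof. by move=> hf hg; apply: FP_tmap; fp. Qed.
#[local] Hint Resolve FP_tstates : fp.

Definition tbest_step (c acc e : tree) : tree :=
  tif (tand (bvsub (hd (hd e)) (hd c)) (tand (bvsub (tl (hd e)) (hd c))
         (tlt (twt acc (tl c)) (twt (bvor (hd (hd e)) (tl e)) (tl c)))))
    (bvor (hd (hd e)) (tl e)) acc.

Definition tbest (R W Z table : tree) : tree :=
  tfold tbest_step (Cons R W) Z table.

Lemma FP_tbest f g h k : FP f -> FP g -> FP h -> FP k ->
  FP (fun x => tbest (f x) (g x) (h x) (k x)).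
Proof.
move=> hf hg hh hk; apply: FP_fold; rewrite /tbest_step; try by fp.
apply: (@growth_additive _ (fun n => 4 * n + 1)); first by poly_tac.
move=> ctx acc e; rewrite tifE; case: (bit _); last by lia.
apply: leq_trans (size_bvor _ _) _.
by move: (tlen_size (hd (hd e))) (size_hd (hd e)) (size_hd e); lia.
Qed.
#[local] Hint Resolve FP_tbest : fp.

(** One recomputation of the whole table. [trim] does not alter characteristic vectors but bounds
    each entry by the length of [Z] whatever the old table held, which keeps the fold polynomial. *)
Definition tround (ctx Xs _ : tree) : tree :=
  tmap (fun c st => trim (hd (tl (hd c)))
          (tbest (tl st) (hd (hd c)) (hd (tl (hd c))) (tl c)))
    (Cons ctx (tzip (tl (tl ctx)) Xs)) (tl (tl ctx)).

Lemma FP_tround_fold f g h : FP f -> FP g -> FP h ->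
  FP (fun x => tfold tround (f x) (g x) (h x)).
Proof.
move=> hf hg hh; apply: FP_fold => //; rewrite /tround.
  by apply: FP_tmap; fp.
apply: (@growth_additive _ (fun n => n * (4 * n + 2) + 1)); first by poly_tac.
move=> ctx acc e; apply: leq_trans (leq_addl _ _).
rewrite -{2}(tseqK (tl (tl ctx))) tmapE size_enc addn1 ltnS /=.
set n := tree_size ctx + _.
have hn : size (tseq (tl (tl ctx))) <= n.
  rewrite size_tseq; move: (tlen_size (tl (tl ctx))) (size_tl ctx) (size_tl (tl ctx)).
  by rewrite /n; lia.
apply: leq_trans (_ : size (tseq (tl (tl ctx))) * (4 * n + 2) <= _); last first.
  by rewrite leq_mul2r hn orbT.
have hz : tlen (hd (tl ctx)) <= n.
  move: (tlen_size (hd (tl ctx))) (size_tl ctx) (size_hd (tl ctx)).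
  by rewrite /n; lia.
elim: (tseq _) => //= st s IH; rewrite mulSn; apply: leq_add => //.
by move: (size_trim (hd (tl ctx)) (tbest (tl st) (hd ctx) (hd (tl ctx))
  (tzip (tl (tl ctx)) acc))); lia.
Qed.
#[local] Hint Resolve FP_tround_fold : fp.

Definition tzeros (U : tree) : tree := tmap (fun _ _ => Nil) Nil U.
Definition tsupp (W : tree) : tree := tmap (fun _ w => tlt Nil w) Nil W.
Definition tcompl (X : tree) : tree := tmap (fun _ x => tnot x) Nil X.
Definition trepeat (Z st : tree) : tree := tmap (fun Z _ => Z) Z st.

Lemma FP_tzeros f : FP f -> FP (fun x => tzeros (f x)).
Proof. by move=> hf; apply: FP_tmap; fp. Qed.
Lemma FP_tsupp f : FP f -> FP (fun x => tsupp (f x)).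
Proof. by move=> hf; apply: FP_tmap; fp. Qed.
Lemma FP_tcompl f : FP f -> FP (fun x => tcompl (f x)).
Proof. by move=> hf; apply: FP_tmap; fp. Qed.
Lemma FP_trepeat f g : FP f -> FP g -> FP (fun x => trepeat (f x) (g x)).
Proof. by move=> hf hg; apply: FP_tmap; fp. Qed.
#[local] Hint Resolve FP_tzeros FP_tsupp FP_tcompl FP_trepeat : fp.

(** Folding over the rows of [M] yields one round per vertex. *)
Definition tphase2 (M W U Z st : tree) : tree :=
  tcompl (tbest U W Z (tzip st
    (tfold tround (Cons W (Cons Z st)) (trepeat Z st) M))).

Definition tsolve (M vs W : tree) : tree :=
  tphase2 M W (tsupp W) (tzeros (tsupp W)) (tstates (tsupp W) vs).

Lemma FP_tsolve f g h : FP f -> FP g -> FP h -> FP (fun x => tsolve (f x) (g x) (h x)).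
Proof. by move=> hf hg hh; rewrite /tsolve /tphase2; fp. Qed.
#[local] Hint Resolve FP_tsolve : fp.

Definition fvst (I : tree) : tree :=
  tsolve (hd I) (tverts (hd I)) (tphase1 (tverts (hd I)) (tl I)).

Lemma FP_fvst : FP fvst.
Proof. by rewrite /fvst; fp. Qed.

(** * Patterns in tournaments *)

Section Tournament.
Variables (V : finType) (A : rel V).
Hypothesis tour : tournament A.

Lemma arcxx x : A x x = false.
Proof. by case: tour => h _; exact: h. Qed.

Lemma arc_asym x y : A x y -> A y x = false.
Proof.
case: (eqVneq x y) => [->|ne]; first by rewrite arcxx.
by case: tour => _ /(_ _ _ ne); case: (A x y) => //; case: (A y x).
Qed.

Lemma arc_total x y : x != y -> A x y || A y x.
Proof. by case: tour => _ h /h; case: (A x y) => //; case: (A y x). Qed.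

(** * Transitive sets as complements of feedback vertex sets *)

Definition transitive_set (X : {set V}) : bool :=
  [forall a in X, forall b in X, forall c in X, A a b ==> A b c ==> A a c].

Lemma transitive_setP (X : {set V}) :
  reflect {in X & &, transitive A} (transitive_set X).
Proof.
apply: (iffP idP) => [h y x z yX xX zX xy yz|h].
  by move/forall_inP/(_ x xX)/forall_inP/(_ y yX)/forall_inP/(_ z zX): h; rewrite xy yz.
apply/forall_inP => a aX; apply/forall_inP => b bX; apply/forall_inP => c cX.
by apply/implyP => ab; apply/implyP => bc; apply: (h b).
Qed.

Lemma transitive_triangle (X : {set V}) a b c : transitive_set X ->
  a \in X -> b \in X -> c \in X -> A a b -> A b c -> A c a = false.
Proof.
move/transitive_setP => h aX bX cX ab bc; apply: arc_asym; exact: (h b).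
Qed.

(** A failure of transitivity closes a directed triangle; conversely, transitivity along a cycle
    would give a loop, against irreflexivity. *)
Lemma fvsP S : feedback_vertex_set A S <-> transitive_set (~: S).
Proof.
split=> [h|/transitive_setP h c cS [c0 /andP[cyc _]]].
  apply/transitive_setP => b a c bX aX cX ab bc.
  have ac : a != c by apply/eqP => e; move: bc; rewrite -e (arc_asym ab).
  case/orP: (arc_total ac) => // ca; case: (h [:: a; b; c]).
    by move=> x; rewrite !inE => /or3P[] /eqP->; rewrite -in_setC.
  split=> //; rewrite /ucycle /= ab bc ca /= !inE negb_or ac !andbT.
  by apply/andP; split; apply/eqP => e; [move: ab | move: bc]; rewrite e arcxx.
case: c c0 cS cyc => // x p _ cS /=; rewrite rcons_path => /andP[pth lst].
have: path A x (rcons p x) by rewrite rcons_path pth.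
have: all (mem (~: S)) (x :: rcons p x).
  apply/allP => y; rewrite inE mem_rcons inE => /or3P[/eqP->|/eqP->|yp]; apply: cS.
  - exact: mem_head.
  - exact: mem_head.
  - by rewrite inE yp orbT.
move=> all_S /(order_path_min_in h all_S) /allP/(_ x).
by rewrite mem_rcons mem_head arcxx => /(_ isT).
Qed.

Definition nbr (x : V) : {set V} := [set y | A x y].

Lemma transitive_setU1 q (X : {set V}) :
  transitive_set X -> X \subset nbr q -> transitive_set (q |: X).
Proof.
move=> /transitive_setP h /subsetP qX; apply/transitive_setP => y x z.
have {}qX u : u \in X -> A q u by move/qX; rewrite inE.
rewrite !in_setU1 => /orP[/eqP->|yX] /orP[/eqP->|xX] /orP[/eqP->|zX] //.
- by rewrite (arc_asym (qX _ xX)).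
- by move=> _; rewrite (arc_asym (qX _ yX)).
- by move=> _ _; apply: qX.
- by move=> _; rewrite (arc_asym (qX _ yX)).
- exact: h.
Qed.

Lemma transitive_setS (X Y : {set V}) :
  Y \subset X -> transitive_set X -> transitive_set Y.
Proof.
move=> /subsetP YX /transitive_setP h; apply/transitive_setP => y x z yY xY zY.
by apply: h; apply: YX.
Qed.

(** Take [q] of maximum out-degree inside [Y]: if some [z] of [Y] beat [q], transitivity would give
    [z] all out-neighbours of [q] in [Y], and [q] itself. *)
Lemma transitive_source (Y : {set V}) : transitive_set Y -> Y != set0 ->
  exists2 q, q \in Y & Y :\ q \subset nbr q.
Proof.
move=> tr /set0Pn[y0 y0Y].
case: (arg_maxnP (P := mem Y) (fun x => #|Y :&: nbr x|) y0Y) => q /= qY qmax.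
exists q => //; apply/subsetP => z; rewrite !inE => /andP[zq zY].
case/orP: (arc_total zq) => // zA; exfalso.
have : #|Y :&: nbr z| <= #|Y :&: nbr q| by exact: qmax.
rewrite leqNgt => /negP[]; apply: proper_card; apply/properP; split.
  apply/subsetP => u; rewrite !inE => /andP[uY qu]; rewrite uY /=.
  by move/transitive_setP: tr => /(_ q z u); apply.
by exists q; rewrite !inE qY ?zA // arcxx.
Qed.

(** The triangles [ai -> v -> bi -> ai] form the matching and the arcs [ai -> bj] make it induced;
    arcs among the [ai] and among the [bi] are left free. *)
Definition pattern (v a1 a2 a3 b1 b2 b3 : V) : bool :=
  [&& [&& A a1 v, A a2 v & A a3 v], [&& A v b1, A v b2 & A v b3],
      [&& A a1 b2 && A a1 b3, A a2 b1 && A a2 b3 & A a3 b1 && A a3 b2]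
    & [&& A b1 a1, A b2 a2 & A b3 a3]].

Definition hits (S : {set V}) (s : seq V) : nat := \sum_(x <- s) (x \in S).

(** If [v] is kept, one vertex of each pair [a i], [b i] is hit; if [v] is hit,
    at most one of these pairs is kept entirely. *)
Lemma pattern_hits v a1 a2 a3 b1 b2 b3 S : pattern v a1 a2 a3 b1 b2 b3 ->
  feedback_vertex_set A S -> 3 <= hits S [:: v; a1; a2; a3; b1; b2; b3].
Proof.
case/and4P=> /and3P[a1v a2v a3v] /and3P[vb1 vb2 vb3].
case/and3P=> /andP[a1b2 a1b3] /andP[a2b1 a2b3] /andP[a3b1 a3b2] /and3P[b1a1 b2a2 b3a3] /fvsP tr.
have pv a b : A a v -> A v b -> A b a -> ~~ [&& v \notin S, a \notin S & b \notin S].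
  move=> av vb ba; apply/negP => /and3P[vS aS bS].
  have := @transitive_triangle _ v b a tr; rewrite !in_setC vS aS bS av.
  by move/(_ isT isT isT vb ba).
(* Whichever way [a] and [a'] are joined, a triangle arises: [b -> a -> a' -> b] or
   [b' -> a' -> a -> b']. *)
have pp a b a' b' : A b a -> A b' a' -> A a b' -> A a' b ->
    ~~ [&& a \notin S, b \notin S, a' \notin S & b' \notin S].
  move=> ba b'a' ab' a'b; apply/negP => /and4P[aS bS a'S b'S].
  have ne : a != a' by apply/eqP => e; move: (arc_asym ba); rewrite e a'b.
  case/orP: (arc_total ne) => h.
    have := @transitive_triangle _ b a a' tr; rewrite !in_setC aS bS a'S a'b.
    by move/(_ isT isT isT ba h).
  have := @transitive_triangle _ b' a' a tr; rewrite !in_setC aS b'S a'S ab'.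
  by move/(_ isT isT isT b'a' h).
have := (pv _ _ a1v vb1 b1a1, pv _ _ a2v vb2 b2a2, pv _ _ a3v vb3 b3a3).
have := (pp _ _ _ _ b1a1 b2a2 a1b2 a2b1, pp _ _ _ _ b1a1 b3a3 a1b3 a3b1,
         pp _ _ _ _ b2a2 b3a3 a2b3 a3b2).
rewrite /hits !big_cons big_nil.
(* What is left is a check over the 128 possible memberships. *)
move: (v \in S) (a1 \in S) (a2 \in S) (a3 \in S) (b1 \in S) (b2 \in S) (b3 \in S).
by do 7!case; case=> [[]] // _ _ _ [[]].
Qed.

(** Two vertices without a prescribed arc between them are joined by a path of length two, and
    [x -> z -> y] excludes [x = y]. *)
Lemma pattern_uniq v a1 a2 a3 b1 b2 b3 : pattern v a1 a2 a3 b1 b2 b3 ->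
  uniq [:: v; a1; a2; a3; b1; b2; b3].
Proof.
case/and4P=> /and3P[a1v a2v a3v] /and3P[vb1 vb2 vb3].
case/and3P=> /andP[a1b2 a1b3] /andP[a2b1 a2b3] /andP[a3b1 a3b2] /and3P[b1a1 b2a2 b3a3].
have ne x y z : A x z -> A z y -> x != y.
  by move=> xz zy; apply/eqP => e; move: (arc_asym xz); rewrite e zy.
have nel x y : A x y -> x != y by move=> xy; apply/eqP => e; move: xy; rewrite e arcxx.
have ner x y : A x y -> y != x by move/nel; rewrite eq_sym.
rewrite /= !inE !negb_or !andbT.
do ![apply/andP; split]; first [by apply: nel | by apply: ner
  | match goal with h1 : is_true (A ?x ?z), h2 : is_true (A ?z ?y)
      |- is_true (?x != ?y) => exact: (ne _ _ _ h1 h2) end].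
Qed.

(** * Dominated sets *)

Definition dominated (U L : {set V}) : {set V} :=
  [set y in U | [forall x in L, A x y]].

Lemma dominatedP (U L : {set V}) y :
  reflect (y \in U /\ {in L, forall x, A x y}) (y \in dominated U L).
Proof. by rewrite inE; apply: (iffP andP) => -[? /forall_inP]. Qed.

Lemma dominatedS (U L L' : {set V}) : L \subset L' -> dominated U L' \subset dominated U L.
Proof.
move=> /subsetP s; apply/subsetP => y /dominatedP[yU h]; apply/dominatedP.
by split=> // x /s; apply: h.
Qed.

(** A minimal subset [K] of [L] dominating the same vertices of [nbr q] gives
    each of its members a private non-out-neighbour, so three members would
    complete a pattern around [q]. *)
Lemma dominated_by_three (U L : {set V}) q :
  (forall v a1 a2 a3 b1 b2 b3, [set v; a1; a2; a3; b1; b2; b3] \subset U ->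
     ~~ pattern v a1 a2 a3 b1 b2 b3) ->
  q \in U -> L \subset U -> {in L, forall x, A x q} ->
  exists s t, dominated U (q |: L) = nbr q :&: (nbr s :&: (nbr t :&: U)).
Proof.
move=> nopat qU LU Lq.
pose P (K : {set V}) := (K \subset L) && (dominated U (q |: K) == dominated U (q |: L)).
have PL : P L by rewrite /P subxx eqxx.
case: (arg_minnP (fun K : {set V} => #|K|) PL) => K /andP[KL /eqP dK] Kmin.
have priv a : a \in K -> exists b,
    [/\ b \in U, A q b, A b a & {in K, forall x, x != a -> A x b}].
  move=> aK; have : ~~ P (K :\ a).
    apply/negP => /Kmin; rewrite leqNgt => /negP[].
    by apply: proper_card; apply: properD1.
  rewrite /P (subset_trans (subD1set _ _) KL) /= -dK eqEsubset.
  rewrite [X in _ && X](dominatedS U (setUS _ (subD1set _ _))) andbT.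
  case/subsetPn=> b /dominatedP[bU h] nb.
  have qb : A q b by apply: h; rewrite setU11.
  have hx : {in K, forall x, x != a -> A x b}.
    by move=> x xK xa; apply: h; rewrite !inE xa xK orbT.
  exists b; split=> //.
  have ab : a != b.
    apply/eqP => e; have := Lq _ (subsetP KL _ aK).
    by rewrite e (arc_asym qb).
  case/orP: (arc_total ab) => // nab.
  case/negP: nb; apply/dominatedP; split=> // x; rewrite in_setU1 => /orP[/eqP->//|xK].
  by case: (eqVneq x a) => [->//|]; apply: hx.
have K2 : #|K| <= 2.
  rewrite leqNgt; apply/negP => /card_gt2P[a1 [a2 [a3 [[a1K a2K a3K] [n12 n23 n31]]]]].
  have [b1 [b1U qb1 ba1 h1]] := priv _ a1K.
  have [b2 [b2U qb2 ba2 h2]] := priv _ a2K.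
  have [b3 [b3U qb3 ba3 h3]] := priv _ a3K.
  have KU x : x \in K -> x \in U by move/(subsetP KL)/(subsetP LU).
  have := @nopat q a1 a2 a3 b1 b2 b3; case/(_ _)/negP.
    apply/subsetP => x; rewrite !inE => /orP[/orP[/orP[/orP[/orP[/orP[]|]|]|]|]|] /eqP-> //;
    exact: KU.
  have KQ x : x \in K -> A x q by move/(subsetP KL)/Lq.
  rewrite /pattern qb1 qb2 qb3 ba1 ba2 ba3 !KQ // !h1 // ?h2 ?h3 //; by rewrite eq_sym.
(* If [K] has fewer than two members, [q] stands in for both or the single member is repeated. *)
have [s [t [/subsetP sK /subsetP Kst]]] : exists s t, [set s; t] \subset q |: K /\ K \subset [set s; t].
  case: (set_0Vmem K) => [->|[s sK]].
    by exists q, q; rewrite sub0set setUid sub1set setU11.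
  case: (set_0Vmem (K :\ s)) => [e|[t]].
    exists s, s; rewrite setUid sub1set inE sK orbT; split=> //.
    by rewrite -setD_eq0 e.
  rewrite !inE => /andP[ts tK]; exists s, t; split.
    by apply/subsetP => x; rewrite !inE => /orP[] /eqP->; rewrite ?sK ?tK orbT.
  have : [set s; t] \subset K.
    by apply/subsetP => x; rewrite !inE => /orP[] /eqP->.
  move=> stK; have : [set s; t] == K by rewrite eqEcard stK cards2 eq_sym ts.
  by move/eqP->.
exists s, t; rewrite -dK; apply/setP => y.
have -> : (y \in nbr q :&: (nbr s :&: (nbr t :&: U))) = [&& A q y, A s y, A t y & y \in U].
  by rewrite !in_setI ![_ \in nbr _]inE.
apply/dominatedP/and4P => [[yU h]|[qy sy ty yU]].
  by split=> //; apply: h; rewrite ?setU11 //; apply: sK; rewrite !inE eqxx ?orbT.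
split=> // x; rewrite in_setU1 => /orP[/eqP->//|/Kst].
by rewrite !inE => /orP[] /eqP->.
Qed.

End Tournament.

(** * Dynamic programming on pattern-free sets *)

Section Dynamic.
Variables (V : finType) (A : rel V).
Hypothesis tour : tournament A.
Variables (u : V -> nat) (U : {set V}).

Definition total (X : {set V}) : nat := \sum_(x in X) u x.

Notation triple := (V * (V * V))%type.

Definition entry_vertex (t : triple) : {set V} := [set t.1] :&: U.
Definition entry_range (t : triple) : {set V} :=
  nbr A t.1 :&: (nbr A t.2.1 :&: (nbr A t.2.2 :&: U)).

Definition best_step (X : triple -> {set V}) (R acc : {set V}) (t : triple) : {set V} :=
  if [&& entry_vertex t \subset R, entry_range t \subset R
       & total acc < total (entry_vertex t :|: X t)]
  then entry_vertex t :|: X t else acc.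

Definition best (ts : seq triple) (X : triple -> {set V}) (R : {set V}) : {set V} :=
  foldl (best_step X R) set0 ts.

Definition round (ts : seq triple) (X : triple -> {set V}) (t : triple) : {set V} :=
  best ts X (entry_range t).

Definition sound (X : triple -> {set V}) : Prop :=
  forall t, X t \subset entry_range t /\ transitive_set A (X t).

Lemma transitive_set0 : transitive_set A set0.
Proof. by apply/transitive_setP => y x z; rewrite inE. Qed.

(** [entry_range t] lies in the out-neighbourhood of [t.1], so adding [t.1] as a source keeps
    transitivity. *)
Lemma best_sound ts X R : sound X ->
  best ts X R \subset R /\ transitive_set A (best ts X R).
Proof.
move=> sX; rewrite /best.
have : set0 \subset R /\ transitive_set A set0 by rewrite sub0set transitive_set0.
elim: ts set0 => //= t ts IH acc h; apply: IH; rewrite /best_step.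
case: ifP => // /and3P[ER RR _]; have [XR tX] := sX t; split.
  by rewrite subUset ER (subset_trans XR).
apply: (@transitive_setS _ _ (t.1 |: X t)); first by rewrite setSU // subsetIl.
by apply: transitive_setU1 => //; apply: subset_trans XR (subsetIl _ _).
Qed.

Lemma round_sound ts n : sound (iter n (round ts) (fun=> set0)).
Proof.
elim: n => [|n IH] t /=; first by rewrite sub0set transitive_set0.
exact: best_sound.
Qed.

(** The total of the accumulator never decreases along the fold. *)
Lemma best_max ts X (R : {set V}) t : t \in ts ->
  entry_vertex t \subset R -> entry_range t \subset R ->
  total (entry_vertex t :|: X t) <= total (best ts X R).
Proof.
have mono s acc : total acc <= total (foldl (best_step X R) acc s).
  elim: s acc => //= t' s IH acc; apply: leq_trans (IH _); rewrite /best_step.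
  by case: ifP => // /and3P[_ _ /ltnW].
rewrite /best; elim: ts set0 => //= t' ts IH acc; rewrite inE => /orP[/eqP->|].
  move=> ER RR; apply: leq_trans (mono _ _); rewrite /best_step ER RR /=.
  by case: ltnP.
exact: IH.
Qed.

Hypothesis nopat : forall v a1 a2 a3 b1 b2 b3, [set v; a1; a2; a3; b1; b2; b3] \subset U ->
     ~~ pattern A v a1 a2 a3 b1 b2 b3.
Variable ts : seq triple.
Hypothesis ts_full : forall t, t \in ts.

(** Induction on the size of [Y]. Removing its source [q] leaves a set dominated by [q] and [L'];
    the range dominated by these is described by one triple, whose entry in the last round is, by
    induction, at least as heavy. *)
Lemma best_complete n (Y L : {set V}) : #|Y| <= n -> Y \subset U -> transitive_set A Y ->
  Y \subset dominated A U L -> L \subset U ->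
  total Y <= total (best ts (iter n (round ts) (fun=> set0)) (dominated A U L)).
Proof.
elim: n Y L => [|n IH] Y L Yn YU tY YL LU.
  by move: Yn; rewrite leqn0 cards_eq0 => /eqP->; rewrite /total big_set0.
case: (set_0Vmem Y) => [->|[y yY]]; first by rewrite /total big_set0.
have [|q qY Yq] := transitive_source tour tY; first by apply/set0Pn; exists y.
(* [L'] gathers all vertices of [U] dominating [q] and the rest of [Y]; as it contains [L], the new
   range lies in the old one, and it still contains [Y']. *)
pose Y' := Y :\ q; pose L' := [set x in U | A x q && (Y' \subset nbr A x)].
have qU := subsetP YU _ qY.
have LL' : L \subset L'.
  apply/subsetP => x xL; rewrite inE (subsetP LU _ xL) /=.
  apply/andP; split; first by case/dominatedP: (subsetP YL _ qY) => _ /(_ _ xL).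
  apply/subsetP => z /setD1P[_ zY]; rewrite inE.
  by case/dominatedP: (subsetP YL _ zY) => _ /(_ _ xL).
have L'U : L' \subset U by apply/subsetP => x; rewrite inE => /andP[].
have [|s [t def]] := dominated_by_three tour nopat qU L'U.
  by move=> x; rewrite inE => /and3P[].
have Eq : entry_vertex (q, (s, t)) = [set q] by apply/setIidPl; rewrite sub1set.
have ER : entry_vertex (q, (s, t)) \subset dominated A U L.
  by apply: (subset_trans (subsetIl _ _)); rewrite sub1set; apply: (subsetP YL).
have RR : entry_range (q, (s, t)) \subset dominated A U L.
  rewrite /entry_range /= -def; apply: dominatedS.
  exact: subset_trans LL' (subsetUr _ _).
apply: leq_trans (best_max _ (ts_full _) ER RR).
have h : total Y' <= total (iter n.+1 (round ts) (fun=> set0) (q, (s, t))).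
  rewrite /= /round /entry_range /= -def; apply: IH.
  - by move: Yn; rewrite (cardsD1 q) qY.
  - exact: subset_trans (subD1set _ _) YU.
  - exact: transitive_setS (subD1set _ _) tY.
  - apply/subsetP => z zY'; apply/dominatedP; split.
      by apply: (subsetP YU); case/setD1P: zY'.
    move=> x; rewrite in_setU1 => /orP[/eqP->|].
      by move/subsetP: Yq => /(_ z zY'); rewrite inE.
    by rewrite inE => /and3P[_ _ /subsetP/(_ z zY')]; rewrite inE.
  - by rewrite subUset sub1set qU.
have [XR _] := round_sound ts n.+1 (q, (s, t)).
(* The entry consists of out-neighbours of [q], hence does not contain [q], and the weights add
   up. *)
rewrite Eq [X in _ <= X]big_setU1 /=; last first.
  by apply/negP => /(subsetP XR); rewrite in_setI inE (arcxx tour).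
by rewrite [X in X <= _](big_setD1 q qY) leq_add2l.
Qed.

(** With no dominating vertices prescribed the range is all of [U], and no [Y] has more than [#|V|]
    members. *)
Lemma best_optimal (Y : {set V}) : transitive_set A Y -> Y \subset U ->
  total Y <= total (best ts (iter #|V| (round ts) (fun=> set0)) U).
Proof.
move=> tY YU; have eU : dominated A U set0 = U.
  by apply/setP => y; rewrite inE; case: (y \in U) => //=; apply/forall_inP => x; rewrite inE.
rewrite -[X in best _ _ X]eU; apply: best_complete => //; last by rewrite sub0set.
- exact: max_card.
- by rewrite eU.
Qed.

End Dynamic.

(** * Correctness of the algorithm *)

Section Semantics.
Variables (V : finType) (A : rel V).
Hypothesis tour : tournament A.

Notation encv f := (enc_seq f (enum V)).

Lemma enc_setE (X : {set V}) (f : V -> bool) :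
  (forall x, f x = (x \in X)) -> encv (fun x => enc_bool (f x)) = enc_set X.
Proof. by move=> h; apply: eq_enc => x _; rewrite h. Qed.

Lemma bvorE (X Y : {set V}) : bvor (enc_set X) (enc_set Y) = enc_set (X :|: Y).
Proof.
rewrite /bvor tzipE tmapE; apply: eq_enc => x _ /=.
by rewrite torE !bit_enc inE.
Qed.

Lemma bvandE (X Y : {set V}) : bvand (enc_set X) (enc_set Y) = enc_set (X :&: Y).
Proof.
rewrite /bvand tzipE tmapE; apply: eq_enc => x _ /=.
by rewrite tandE !bit_enc inE.
Qed.

Lemma bvsubE (X Y : {set V}) : bvsub (enc_set X) (enc_set Y) = enc_bool (X \subset Y).
Proof.
rewrite /bvsub tzipE tallE; congr enc_bool; apply/allP/subsetP => h x.
  by move=> xX; have := h x (mem_enum _ x); rewrite /= torE tnotE !bit_enc xX.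
by move=> _; rewrite /= torE tnotE !bit_enc; case: (boolP (x \in X)) => // /h.
Qed.

Lemma trimE (f : V -> tree) (X : {set V}) : trim (encv f) (enc_set X) = enc_set X.
Proof.
rewrite /trim tzipE tmapE; apply: eq_enc => x _ /=.
by case: (x \in X).
Qed.

(** The unit vector of the vertex at position [size s1] is kept without trailing zeros and padded
    here; [uniq] makes positions determine vertices. *)
Lemma trim_unit (f : V -> tree) s1 x s2 : uniq (s1 ++ x :: s2) ->
  trim (enc_seq f (s1 ++ x :: s2)) (enc_seq id (nseq (size s1) Nil ++ [:: tt])) =
  enc_seq (fun y => enc_bool (y == x)) (s1 ++ x :: s2).
Proof.
rewrite /trim tzipr.
set h := fun (_ e : tree) => _.
have mapC z t : tmap h Nil (Cons z t) = Cons (h Nil z) (tmap h Nil t).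
  by rewrite -(tseqK t) -[Cons z _]/(enc_seq id (z :: tseq t)) !tmapE.
elim: s1 => [|y s1 IH] /=.
  move=> /andP[xs2 _]; rewrite mapC /= eqxx; congr Cons.
  elim: s2 xs2 => //= y s2 IH; rewrite inE negb_or => /andP[xy /IH e].
  by rewrite mapC e eq_sym (negbTE xy).
rewrite mem_cat inE !negb_or => /andP[/and3P[_ yx _] u].
by rewrite mapC (IH u) (negbTE yx).
Qed.

Lemma tvertsE (f : V -> tree) :
  tverts (encv f) = encv (fun x => Cons (enc_set [set x]) (f x)).
Proof.
rewrite /tverts -[RHS]trevK trevE; congr trev.
set b := (X in tfold X).
(* [s1] is the processed prefix, and its length is the number of zeros in front of the current
   one. *)
suff h s1 s2 out : s1 ++ s2 = enum V ->
   tl (tfold b (encv f) (Cons (enc_seq id (nseq (size s1) Nil ++ [:: tt])) out) (enc_seq f s2))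
   = tapp (enc_seq (fun x => Cons (enc_set [set x]) (f x)) (rev s2)) out.
  exact: etrans (h [::] (enum V) Nil erefl) (tapp_Nil _).
elim: s2 s1 out => [|x s2 IH] s1 out e //=.
rewrite {2}/b /= -e trim_unit ?e ?enum_uniq //.
have -> : Cons Nil (enc_seq id (nseq (size s1) Nil ++ [:: tt])) =
          enc_seq id (nseq (size (rcons s1 x)) Nil ++ [:: tt]).
  by rewrite size_rcons.
rewrite IH ?cat_rcons // rev_cons /tapp !trevE rev_rcons /=.
by rewrite (@enc_setE [set x]) => [|y]; last by rewrite inE.
Qed.

Definition vert (x : V) : tree := Cons (enc_set [set x]) (enc_set (nbr A x)).

Lemma tverts_adj :
  tverts (encv (fun x => encv (fun y => enc_bool (A x y)))) = encv vert.
Proof.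
rewrite tvertsE; apply: eq_enc => x _; rewrite /vert; congr Cons.
by apply: enc_setE => y; rewrite inE.
Qed.

Lemma tarcE x y : tarc (vert x) (vert y) = enc_bool (A x y).
Proof. by rewrite /tarc bvsubE sub1set inE. Qed.

Definition wsum (W : V -> tree) (X : {set V}) : nat := \sum_(x in X) val (W x).

Lemma twtE (X : {set V}) (W : V -> tree) : val (twt (enc_set X) (encv W)) = wsum W X.
Proof.
rewrite /twt tzipE tfoldE /wsum.
have -> : \sum_(x in X) val (W x) = val Nil + \sum_(x <- enum V | x \in X) val (W x).
  by rewrite big_enum_cond; apply: eq_bigl => x; rewrite inE.
suff h s acc : val (foldl (fun acc x => tadd acc (tif (enc_bool (x \in X)) (W x) Nil)) acc s)
    = val acc + \sum_(x <- s | x \in X) val (W x) by exact: h.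
elim: s acc => [|x s IH] acc /=; first by rewrite big_nil addn0.
rewrite IH val_tadd big_cons tifE bit_enc.
by case: (x \in X) => /=; lia.
Qed.

Lemma tminwE (X : {set V}) (W : V -> tree) x0 : x0 \in X ->
  let m := val (tminw (enc_set X) (encv W)) in
  (forall x, x \in X -> m <= val (W x)) /\ exists2 x, x \in X & m = val (W x).
Proof.
move=> x0X; rewrite /tminw tzipE tfoldE /=.
set tot := twt _ _; set r := foldl _ _ _.
have htot x : val (W x) <= val tot.
  rewrite /tot tmapE (@enc_setE setT (fun=> true)) => [|y]; last by rewrite inE.
  by rewrite twtE /wsum (bigD1 x) ?inE //= leq_addr.
have [h1 h2 h3] : [/\ val r <= val tot, forall x, x \in enum V -> x \in X -> val r <= val (W x) &
    r = tot \/ exists2 x, x \in X & r = W x].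
  rewrite /r; elim: (enum V) tot {htot r} => [|y s IH] acc /=; first by split=> //; left.
  rewrite tifE tandE !bit_enc tltE bit_enc.
  case: (IH (if (y \in X) && (val (W y) < val acc) then W y else acc)).
  set r := foldl _ _ _ => h1 h2 h3; split.
  - by apply: leq_trans h1 _; case: ifP => // /andP[_ /ltnW].
  - move=> x; rewrite inE => /orP[/eqP->|xs] xX; last exact: h2.
    by apply: leq_trans h1 _; rewrite xX /=; case: ltnP.
  - case: h3 => [->|]; last by right.
    by case: ifP => [/andP[yX _]|_]; [right; exists y | left].
split=> [x|]; first by apply: h2; rewrite mem_enum.
(* If the fold still holds the total, this is at least the weight of [x0] and, by [h2], at most that
   weight, so [x0] attains it. *)
case: h3 => [e|[x xX ->]]; last by exists x.
exists x0 => //; apply/eqP; rewrite eqn_leq h2 ?mem_enum //= e; exact: htot.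
Qed.

Lemma treduceE m (H : {set V}) (W : V -> tree) :
  treduce m (enc_set H) (encv W) =
  encv (fun x => tsub (W x) (if x \in H then m else Nil)).
Proof.
rewrite /treduce tzipE tmapE; apply: eq_enc => x _ /=.
by rewrite tifE bit_enc.
Qed.

(** * The local ratio step and its inequality *)

Notation T7 := (V * (V * (V * (V * (V * (V * V))))))%type.

Definition enc7 (t : T7) : tree :=
  Cons (vert t.1) (Cons (vert t.2.1) (Cons (vert t.2.2.1) (Cons (vert t.2.2.2.1)
    (Cons (vert t.2.2.2.2.1) (Cons (vert t.2.2.2.2.2.1) (vert t.2.2.2.2.2.2)))))).

Definition seq7 (t : T7) : seq V :=
  [:: t.1; t.2.1; t.2.2.1; t.2.2.2.1; t.2.2.2.2.1; t.2.2.2.2.2.1; t.2.2.2.2.2.2].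

Definition pattern7 (t : T7) : bool :=
  pattern A t.1 t.2.1 t.2.2.1 t.2.2.2.1 t.2.2.2.2.1 t.2.2.2.2.2.1 t.2.2.2.2.2.2.

Lemma tpatE t : tpat (enc7 t) = enc_bool (pattern7 t).
Proof.
rewrite /tpat /= /tpat_at !tarcE !tandE !bit_enc /pattern7 /pattern; congr enc_bool.
by rewrite -!andbA; do ![case: (A _ _) => //=].
Qed.

Lemma tsetE t : tset (enc7 t) = enc_set [set x in seq7 t].
Proof.
rewrite /tset /= !bvorE; congr enc_set; apply/setP => x; rewrite !inE.
by [].
Qed.

(** The removed weight is constant on the seven vertices of a pattern and zero elsewhere, so any [S]
    loses at most seven times the constant and a feedback vertex set [S'] at least three times. The
    additive form lets successive steps telescope. *)
Lemma treduce_stepE (W : V -> tree) t : exists W' : V -> tree,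
  [/\ treduce_step Nil (encv W) (enc7 t) = encv W',
      forall x, val (W' x) <= val (W x),
      pattern7 t -> exists2 x, x \in seq7 t & val (W' x) = 0 &
      forall S S' : {set V}, feedback_vertex_set A S' ->
        3 * wsum W S + 7 * wsum W' S' <= 7 * wsum W S' + 3 * wsum W' S].
Proof.
rewrite /treduce_step tpatE tsetE treduceE tifE bit_enc.
set H := [set x in seq7 t].
set m := if pattern7 t then _ else _.
exists (fun x => tsub (W x) (if x \in H then m else Nil)).
have [hle hex] : (forall x, x \in H -> val m <= val (W x)) /\
    (pattern7 t -> exists2 x, x \in H & val m = val (W x)).
  have tH : t.1 \in H by rewrite inE mem_head.
  have [h1 h2] := tminwE W tH.
  by rewrite /m; case: (pattern7 t); split.
have hval x : val (tsub (W x) (if x \in H then m else Nil)) = val (W x) - (x \in H) * val m.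
  have [r [_ _ ->]] := tsubE (W x) (if x \in H then m else Nil).
    by case: ifP => _ /=; rewrite ?mul1n ?mul0n.
  by case: ifP => // /hle.
split=> //.
- by move=> x; rewrite hval leq_subr.
- move/hex=> [x xH e]; exists x; first by rewrite inE in xH.
  by rewrite hval xH e mul1n subnn.
move=> S S' fvsS'.
have split_sum X : wsum W X = wsum (fun x => tsub (W x) (if x \in H then m else Nil)) X
    + #|X :&: H| * val m.
  rewrite /wsum -sum1_card big_distrl /=.
  rewrite [X in _ + X](_ : _ = \sum_(x in X) (x \in H) * val m).
    rewrite -big_split /=; apply: eq_bigr => x _; rewrite hval.
    by case: (boolP (x \in H)) => [/hle|_] /=; lia.
  rewrite big_mkcond [RHS]big_mkcond /=; apply: eq_bigr => x _; rewrite inE.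
  by case: (x \in X); case: (x \in H).
rewrite !split_sum.
have [pat|npat] := boolP (pattern7 t); last first.
  by rewrite /m (negbTE npat) /=; lia.
have uH : uniq (seq7 t) by exact: pattern_uniq pat.
have cardH X : #|X :&: H| = hits X (seq7 t).
  have -> : #|X :&: H| = #|[seq x <- seq7 t | x \in X]|.
    by apply: eq_card => x; rewrite mem_filter in_setI in_set.
  rewrite (card_uniqP (filter_uniq _ uH)) size_filter -sum1_count big_mkcond /=.
  by apply: eq_bigr => x _; case: (x \in X).
have h3 : 3 <= #|S' :&: H| by rewrite cardH; exact: (pattern_hits tour pat fvsS').
have h7 : #|S :&: H| <= 7.
  by apply: leq_trans (subset_leq_card (subsetIr _ _)) _; rewrite cardsE (card_uniqP uH).
by nia.
Qed.

(** A weight once zero stays zero, since weights only decrease, and the inequalities telescope. *)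
Lemma treduce_foldE (s : seq T7) (W : V -> tree) : exists W' : V -> tree,
  [/\ tfold treduce_step Nil (encv W) (enc_seq enc7 s) = encv W',
      forall x, val (W' x) <= val (W x),
      forall t, t \in s -> pattern7 t -> exists2 x, x \in seq7 t & val (W' x) = 0 &
      forall S S' : {set V}, feedback_vertex_set A S' ->
        3 * wsum W S + 7 * wsum W' S' <= 7 * wsum W S' + 3 * wsum W' S].
Proof.
elim: s W => [|t s IH] W; first by exists W; split=> // S S' _; lia.
have [W1 [e1 le1 z1 r1]] := treduce_stepE W t.
have [W2 [e2 le2 z2 r2]] := IH W1.
exists W2; split.
- by rewrite [enc_seq _ _]/= [tfold _ _ _ _]/= e1.
- by move=> x; apply: leq_trans (le1 x).
- move=> t'; rewrite inE => /orP[/eqP->|]; last exact: z2.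
  move=> /z1[x xt e]; exists x => //; by apply/eqP; rewrite -leqn0 -e.
- by move=> S S' h; have := r1 S S' h; have := r2 S S' h; lia.
Qed.

(** * Tables of the dynamic programme *)

Notation T3 := (V * (V * V))%type.

Definition enc3 (t : T3) : tree := Cons (vert t.1) (Cons (vert t.2.1) (vert t.2.2)).

Definition all3 : seq T3 := [seq (x, y) | x <- enum V, y <- [seq (y, z) | y <- enum V, z <- enum V]].

Lemma mem_all3 t : t \in all3.
Proof.
case: t => x [y z]; apply/allpairsP; exists (x, (y, z)); split; rewrite ?mem_enum //.
by apply/allpairsP; exists (y, z); rewrite !mem_enum.
Qed.

Definition all7 : seq T7 :=
  let p (T : Type) (s : seq T) := [seq (x, y) | x <- enum V, y <- s] in
  p _ (p _ (p _ (p _ (p _ (p _ (enum V)))))).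

Lemma mem_all7 t : t \in all7.
Proof.
case: t => a [b [c [d [e [f g]]]]]; rewrite /all7.
by do 6!(apply/allpairsP; eexists (_, _); split;
  [ rewrite mem_enum // | rewrite /= | reflexivity ]); rewrite mem_enum.
Qed.

Lemma tprod3E : tprod (encv vert) (tprod (encv vert) (encv vert)) = enc_seq enc3 all3.
Proof. by rewrite !tprodE. Qed.

Lemma tprod7E : let p := tprod (encv vert) in
  p (p (p (p (p (p (encv vert)))))) = enc_seq enc7 all7.
Proof. by rewrite /= !tprodE. Qed.

Definition enc_entry (U : {set V}) (t : T3) : tree :=
  Cons (enc_set (entry_vertex U t)) (enc_set (entry_range A U t)).

Lemma tstatesE (U : {set V}) :
  tstates (enc_set U) (encv vert) = enc_seq (enc_entry U) all3.
Proof.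
rewrite /tstates tprod3E tmapE; apply: eq_enc => t _ /=.
by rewrite !bvandE.
Qed.

Section Phase2.
Variables (W : V -> tree) (U : {set V}).
Let u (x : V) := val (W x).
Notation enc_table X := (enc_seq (fun t => enc_set (X t)) all3).

Lemma tbestE (X : T3 -> {set V}) (R : {set V}) :
  tbest (enc_set R) (encv W) (@enc_set V set0) (tzip (enc_seq (enc_entry U) all3) (enc_table X))
  = enc_set (best A u U all3 X R).
Proof.
rewrite /tbest tzipE tfoldE /best.
elim: all3 set0 => //= t s IH acc; rewrite -IH; congr foldl.
rewrite /tbest_step /= !bvorE !bvsubE tltE !twtE !tandE !bit_enc tifE bit_enc.
by rewrite /best_step; case: ifP.
Qed.

Lemma tround_foldE (f : V -> tree) :
  tfold tround (Cons (encv W) (Cons (@enc_set V set0) (enc_seq (enc_entry U) all3)))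
    (enc_table (fun=> set0 : {set V})) (encv f) =
  enc_table (iter #|V| (round A u U all3) (fun=> set0)).
Proof.
have -> : #|V| = size (enum V) by rewrite -cardE.
rewrite tfoldE.
set c := Cons (encv W) _.
suff h s X : foldl (fun acc x => tround c acc (f x)) (enc_table X) s =
    enc_table (iter (size s) (round A u U all3) X) by exact: (h _ (fun=> set0)).
elim: s X => // x s IH X.
rewrite [foldl _ _ _]/= iterSr -IH; congr foldl.
rewrite /tround /= tmapE; apply: eq_enc => t _ /=.
by rewrite tbestE trimE.
Qed.

End Phase2.

Lemma tsolveE (f W : V -> tree) : let U := [set x | 0 < val (W x)] in
  tsolve (encv f) (encv vert) (encv W) =
  enc_set (~: best A (fun x => val (W x)) U all3
    (iter #|V| (round A (fun x => val (W x)) U all3) (fun=> set0)) U).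
Proof.
move=> U; rewrite /tsolve /tphase2.
have -> : tsupp (encv W) = enc_set U.
  by rewrite /tsupp tmapE; apply: eq_enc => x _; rewrite tltE inE.
have -> : tzeros (enc_set U) = @enc_set V set0.
  by rewrite /tzeros tmapE; apply: eq_enc => x _; rewrite inE.
rewrite tstatesE.
have -> : trepeat (@enc_set V set0) (enc_seq (enc_entry U) all3) =
  enc_seq (fun t => enc_set ((fun=> set0) t : {set V})) all3 by rewrite /trepeat tmapE.
rewrite tround_foldE tbestE /tcompl tmapE; apply: eq_enc => x _.
by rewrite tnotE bit_enc in_setC.
Qed.

(** * Conversion of the weights and the approximation bound *)

Lemma val_enc_nat n : val (enc_nat n) = n.
Proof.
(* Generalised over the starting digit for the induction; with [m = 0] and [up_log 2 n.+1] digits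
   the modulus exceeds [n]. *)
have h k m : val (enc_seq enc_bool [seq odd (n %/ 2 ^ i) | i <- iota m k]) =
    (n %/ 2 ^ m) %% 2 ^ k.
  elim: k m => [|k IH] m /=; first by rewrite expn0 modn1.
  rewrite bit_enc IH !expnS [2 * 2 ^ m]mulnC divnMA.
  set q := n %/ 2 ^ m.
  have e : q = q %/ 2 %/ 2 ^ k * (2 * 2 ^ k) + (q %% 2 + 2 * (q %/ 2 %% 2 ^ k)).
    rewrite {1}(divn_eq q 2) {1}(divn_eq (q %/ 2) (2 ^ k)).
    by move: (q %/ 2 %/ 2 ^ k) (q %/ 2 %% 2 ^ k) (q %% 2) (2 ^ k) => a b r p; nia.
  have h1 : q %% 2 < 2 by rewrite ltn_mod.
  have h2 : q %/ 2 %% 2 ^ k < 2 ^ k by rewrite ltn_mod expn_gt0.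
  rewrite -{1}modn2 [in RHS]e modnMDl [RHS]modn_small //.
  by move: h1 h2; move: (q %% 2) (q %/ 2 %% 2 ^ k) (2 ^ k) => r b p; lia.
rewrite /enc_nat /nat_bits h expn0 divn1 modn_small //.
exact: up_logP.
Qed.

Lemma tdensE (w : V -> rat) x :
  val (tdens (enc_set [set x]) (encv (fun y => enc_rat (w y)))) =
  \prod_(y | y != x) `|denq (w y)|%N.
Proof.
rewrite /tdens tzipE tfoldE.
have -> : \prod_(y | y != x) `|denq (w y)|%N =
    val (Cons tt Nil) * \prod_(y <- enum V | y != x) `|denq (w y)|%N.
  by rewrite mul1n big_enum_cond; apply: eq_bigl => y; rewrite inE.
suff h s acc : val (foldl (fun acc y => tmul acc (tif (enc_bool (y \in [set x]))
     (Cons tt Nil) (enc_nat `|denq (w y)|%N))) acc s)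
   = val acc * \prod_(y <- s | y != x) `|denq (w y)|%N by exact: h.
elim: s acc => [|y s IH] acc /=; first by rewrite big_nil muln1.
rewrite IH (proj2 (tmulE _ _)) big_cons tifE bit_enc inE.
by case: (y == x) => /=; rewrite ?val_enc_nat ?muln1 // mulnA.
Qed.

Lemma tweightsE (w : V -> rat) : exists W : V -> tree,
  tweights (encv vert) (encv (fun y => enc_rat (w y))) = encv W /\
  forall x, val (W x) = `|numq (w x)|%N * \prod_(y | y != x) `|denq (w y)|%N.
Proof.
exists (fun x => tmul (enc_nat `|numq (w x)|%N)
  (tdens (enc_set [set x]) (encv (fun y => enc_rat (w y))))); split.
  by rewrite /tweights tzipE tmapE.
by move=> x; rewrite (proj2 (tmulE _ _)) val_enc_nat tdensE.
Qed.

(** By the telescoped inequality it is enough to be optimal for the residual weights [W]: then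
    [3 * wsum W (~: X) <= 7 * wsum W S'] absorbs the residual terms. *)
Lemma fvstE (w : V -> rat) : exists (W : V -> tree) (S : {set V}),
  [/\ forall x, val (W x) = `|numq (w x)|%N * \prod_(y | y != x) `|denq (w y)|%N,
      fvst (enc_instance A w) = enc_set S, feedback_vertex_set A S &
      forall S' : {set V}, feedback_vertex_set A S' -> 3 * wsum W S <= 7 * wsum W S'].
Proof.
have [W1 [eW1 hW1]] := tweightsE w.
have [W [eW _ zW rW]] := treduce_foldE all7 W1.
pose u x := val (W x); pose U := [set x | 0 < u x].
pose X := best A u U all3 (iter #|V| (round A u U all3) (fun=> set0)) U.
exists W1, (~: X); split=> //.
- rewrite /fvst /enc_instance /= tverts_adj /tphase1 eW1 [X in tfold _ _ _ X]tprod7E eW.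
  exact: tsolveE.
- apply/(fvsP tour); rewrite setCK.
  by have [] := best_sound tour u all3 U (round_sound tour u U all3 #|V|).
move=> S' fS'; have := rW (~: X) S' fS'.
suff : wsum W (~: X) <= wsum W S' by lia.
(* The local ratio phase left a vertex of residual weight zero in every pattern. *)
have nopat v a1 a2 a3 b1 b2 b3 : [set v; a1; a2; a3; b1; b2; b3] \subset U ->
    ~~ pattern A v a1 a2 a3 b1 b2 b3.
  move=> /subsetP sU; apply/negP => pat.
  have [x xt x0] := zW (v, (a1, (a2, (a3, (b1, (b2, b3)))))) (mem_all7 _) pat.
  have : x \in U by apply: sU; move: xt; rewrite !inE -!orbA.
  by rewrite inE /u x0.
(* What [S'] keeps outside [U] has residual weight zero, so intersecting with [U] costs nothing. *)
have tY : transitive_set A (~: S' :&: U).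
  by apply: transitive_setS (subsetIl _ _) _; apply/(fvsP tour).
have := best_optimal tour u nopat mem_all3 tY (subsetIr _ _); rewrite -/X.
have tot Y : wsum W [set: V] = wsum W Y + wsum W (~: Y).
  by rewrite /wsum (big_setID Y) /= setTI setTD.
have -> : total u (~: S' :&: U) = wsum W (~: S').
  rewrite /total /wsum [RHS](big_setID U) /= [X in _ = _ + X]big1 ?addn0 // => x.
  by rewrite !inE /u -eqn0Ngt => /andP[/eqP].
rewrite -[total u X]/(wsum W X).
by move: (tot X) (tot S'); lia.
Qed.

End Semantics.

(** * Return to rational weights and conclusion *)

Import GRing.Theory Num.Theory Order.TTheory.

(** A numerator times the other denominators is the weight times all denominators; non-negativity
    makes the absolute value of the numerator harmless. *)
Lemma scaled_weight (V : finType) (w : V -> rat) (W : V -> tree) (S : {set V}) :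
  (forall v : V, 0 <= w v)%R ->
  (forall x, val (W x) = `|numq (w x)|%N * \prod_(y | y != x) `|denq (w y)|%N) ->
  ((wsum W S)%:R = weight w S * (\prod_y `|denq (w y)|%N)%:R)%R.
Proof.
move=> w0 hW; rewrite /wsum /weight natr_sum mulr_suml; apply: eq_bigr => x _.
have -> : \prod_y `|denq (w y)|%N = `|denq (w x)|%N * \prod_(y | y != x) `|denq (w y)|%N.
  by rewrite (bigD1 x).
rewrite hW !natrM mulrA; congr (_ * _)%R.
have -> : (`|denq (w x)|%N%:R = (denq (w x))%:~R :> rat)%R.
  by rewrite natr_absz ger0_norm ?denq_ge0.
have -> : (`|numq (w x)|%N%:R = (numq (w x))%:~R :> rat)%R.
  by rewrite natr_absz ger0_norm ?numq_ge0.
by rewrite numqE.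
Qed.

Theorem theorem1 :
  exists (P : cmd) (a k : nat),
    forall (V : finType) (A : rel V) (w : V -> rat),
      tournament A -> (forall v : V, 0 <= w v)%R ->
      exists (t : nat) (S : {set V}) (opt : rat),
        [/\ runs P (enc_instance A w) t (enc_set S),
            t <= a * tree_size (enc_instance A w) ^ k + a,
            feedback_vertex_set A S,
            min_fvs_weight A w opt
          & (weight w S <= 7 / 3 * opt)%R].
Proof.
have [P [N [a [k [_ _ cP]]]]] := FP_fvst.
(* The factor [2 ^ k] comes from [n.+1 <= 2 * n] for the positive size [n] of the instance. *)
exists P, (a * 2 ^ k), k => V A w tour w0.
set I := enc_instance A w.
have [t [s [ex s0 tle _]]] := cP (upd (fun=> Nil) 0 I).
have [W [S [hW eS fS apx]]] := fvstE tour w.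
have scale X := scaled_weight X w0 hW.
set D : rat := ((\prod_y `|denq (w y)|%N)%:R)%R in scale.
have D0 : (0 < D)%R.
  by rewrite ltr0n prodn_gt0 // => y; rewrite absz_gt0 denq_neq0.
have le_weight X Y : wsum W X <= wsum W Y -> (weight w X <= weight w Y)%R.
  by rewrite -(ler_nat rat) !scale ler_pM2r.
(* The set of all vertices is feasible, so a minimiser exists and realises [opt]. *)
have fT : transitive_set A (~: [set: V]) by rewrite setCT transitive_set0.
have [S' /(fvsP tour) fS' S'min] :=
  arg_minnP (P := fun X : {set V} => transitive_set A (~: X)) (wsum W) fT.
exists t, S, (weight w S'); split=> //.
- by exists s; split=> //; rewrite s0.
- apply: leq_trans tle _; rewrite /upd /= /pb.
  apply: leq_trans (leq_addr _ _); rewrite -mulnA -expnMn leq_mul2l.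
  apply/orP; right; have := tree_size_gt0 I.
  by case: (k) => // k' h; rewrite leq_exp2r //; lia.
- by split=> [|X /(fvsP tour) fX]; [exists S' | apply/le_weight/S'min].
have := apx S' fS'; rewrite -(ler_nat rat) !natrM !scale !mulrA ler_pM2r // => h.
by rewrite mulrAC ler_pdivlMr // mulrC.
Qed.
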